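(* Let $M$ be a manifold carrying a regular quasihomogeneous flat pencil $(\ ,\ )_1$, $(\ ,\ )_2$ of degree $d$, with function $\tau$ and vector fields $E=\nabla_1\tau$, $e=\nabla_2\tau$. Let $M_0\subset M$ be the subset where the metric $(\ ,\ )_2$ is invertible. Define a multiplication of 1-forms on $M_0$ by $$u\cdot v:=\Delta(u,R^{-1}v).$$ Then there exists a unique Frobenius structure on $M_0$ such that $\langle\ ,\ \rangle=(\ ,\ )_2$, the multiplication of tangent vectors is $\langle\ ,\ \rangle$-dual to the product $u\cdot v$ of 1-forms, the unity vector field is $e$, the Euler vector field is $E$, and the intersection form is equal to $(\ ,\ )_1$.
   Context: Summation over repeated indices is assumed; $\mathcal L$ denotes Lie derivative. **Flat pencils.** A contravariant metric on a smooth manifold $M$ is a symmetric bilinear form on $T^*M$ that is invertible on an open dense subset. In local coordinates write $g^{ij}=(dx^i,dx^j)$. Its contravariant Levi-Civita connection is a collection of functions $\Gamma_k^{ij}(x)$, defined in every coordinate patch on all of $M$, such that where $(g^{ij})$ is invertible $\Gamma_k^{ij}=-g^{is}\Gamma_{sk}^j$, with $\Gamma_{sk}^j$ the Levi-Civita connection of the inverse metric $g_{ij}dx^idx^j$. The contravariant metric is flat if, where it is invertible, the inverse metric is flat. Two contravariant metrics $(\ ,\ )_1,(\ ,\ )_2$ form a flat pencil if: (1) $(\ ,\ )_1-\lambda(\ ,\ )_2$ is a contravariant metric on $M$ for every $\lambda$; (2) if ${\Gamma_1}_k^{ij}$, ${\Gamma_2}_k^{ij}$ are their contravariant Levi-Civita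 connections, then ${\Gamma_1}_k^{ij}-\lambda{\Gamma_2}_k^{ij}$ is the contravariant Levi-Civita connection of $(\ ,\ )_1-\lambda(\ ,\ )_2$ for every $\lambda$; (3) $(\ ,\ )_1-\lambda(\ ,\ )_2$ is flat for every $\lambda$. The flat pencil is quasihomogeneous of degree $d$ if there is a function $\tau$ on $M$ such that the vector fields $E=\nabla_1\tau$, $E^i:=g_1^{is}\partial_s\tau$, and $e=\nabla_2\tau$, $e^i:=g_2^{is}\partial_s\tau$, satisfy $[e,E]=e$, $\mathcal L_E(\ ,\ )_1=(d-1)(\ ,\ )_1$, $\mathcal L_e(\ ,\ )_1=(\ ,\ )_2$, $\mathcal L_e(\ ,\ )_2=0$. **The operators $R$ and $\Delta$.** On $M_0$ let ${\nabla_2}_i$ be the Levi-Civita covariant derivative of $(\ ,\ )_2$ and $R_i^j=\frac{d-1}{2}\delta_i^j+{\nabla_2}_iE^j$, acting on 1-forms by $(Rv)_i=R_i^jv_j$. The pencil is regular if $R$ is nondegenerate at every point. On $M_0$ the operation $\Delta$ on 1-forms is $\Delta(u,v)_k=u_iv_j\Delta_k^{ij}$, where $\Delta_i^{jk}={g_2}_{is}\Delta^{sjk}$, $({g_2}_{ij})=(g_2^{ij})^{-1}$, and $\Delta^{ijk}=g_2^{js}{\Gamma_1}_s^{ik}-g_1^{is}{\Gamma_2}_s^{jk}$. **Frobenius manifolds.** A Frobenius algebra is a commutative associative algebra with unity together with a symmetric nondegenerate bilinear form $\langle\ ,\ \rangle$ satisfying $\langle ab,c\rangle=\langle a,bc\rangle$.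 A Frobenius structure of charge $d$ on a manifold is a structure of Frobenius algebra on each tangent space, depending smoothly on the point, such that: (FM1) the metric $\langle\ ,\ \rangle$ is flat; with $\nabla$ its Levi-Civita connection, the unity vector field $e$ satisfies $\nabla e=0$; (FM2) with $c(u,v,w):=\langle u\cdot v,w\rangle$, the four-linear form $(\nabla_z c)(u,v,w)$ is symmetric in $u,v,w,z$; (FM3) a vector field $E$ (the Euler vector field) is fixed with $\nabla\nabla E=0$, such that with $Q=\mathrm{id}+\mathrm{ad}_E$ one has $Q(ab)=Q(a)b+aQ(b)$ and $E\langle a,b\rangle+d\langle a,b\rangle=\langle Q(a),b\rangle+\langle a,Q(b)\rangle$ for all vector fields $a,b$. The metric $\langle\ ,\ \rangle$ is also regarded as a bilinear form on $T^*$ (by the inverse matrix), and it identifies tangent and cotangent spaces, so the product on tangent vectors yields a dual product on 1-forms. The intersection form is the bilinear form $(\omega_1,\omega_2)\mapsto i_E(\omega_1\cdot\omega_2)$ on 1-forms, $i_E$ being contraction with $E$. *)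

(* Defs.v *)
From HB Require Import structures.
From mathcomp Require Import all_boot all_order all_algebra.
From mathcomp Require Import all_classical all_reals all_analysis.

Set Implicit Arguments.
Unset Strict Implicit.
Unset Printing Implicit Defensive.

Import Order.TTheory GRing.Theory Num.Theory.
Import numFieldNormedType.Exports.

Local Open Scope classical_set_scope.
Local Open Scope ring_scope.

(* Vectors v^i and covectors u_i are both rows of components. Index orders:
   a connection G_k^{ij} is (G k i j), Christoffel symbols G_{ij}^k are
   (christoffel h x i j k), a product c_{ij}^k is (c i j k). *)

Section LocalCalculus.
Context {R : realType} {n : nat}.
Local Notation V := 'rV[R]_n.
Implicit Types (h : V -> 'M[R]_n) (v w : V -> V) (x : V).

Definition pd (i : 'I_n) (f : V -> R) (x : V) : R := 'D_(delta_mx 0 i) f x.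

(* Infinitely Frechet-differentiable on A (used for open A only): every
   iterated partial derivative is differentiable. *)
Definition smooth_on (A : set V) (f : V -> R) : Prop :=
  forall (s : seq 'I_n) (x : V), A x -> differentiable (foldr pd f s) x.

(* In the next definitions h is a covariant metric (h_{ij}). *)
Definition christoffel h x (i j k : 'I_n) : R :=
  2^-1 * \sum_l (invmx (h x) k l *
    (pd i (fun y => h y l j) x + pd j (fun y => h y l i) x
     - pd l (fun y => h y i j) x)).

(* R_{ij}{}^l{}_k, the l-component of [nabla_i, nabla_j] d_k. *)
Definition curvature h x (i j k l : 'I_n) : R :=
  pd i (fun y => christoffel h y j k l) x
  - pd j (fun y => christoffel h y i k l) x
  + \sum_m (christoffel h x i m l * christoffel h x j k m
            - christoffel h x j m l * christoffel h x i k m).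

(* nabla_i v^j *)
Definition nabla h v x (i j : 'I_n) : R :=
  pd i (fun y => v y 0 j) x + \sum_s (christoffel h x i s j * v x 0 s).

(* nabla_i nabla_j v^k *)
Definition nabla2 h v x (i j k : 'I_n) : R :=
  pd i (fun y => nabla h v y j k) x
  - \sum_m (christoffel h x i j m * nabla h v x m k)
  + \sum_m (christoffel h x i m k * nabla h v x j m).

(* nabla_l t_{ijk} *)
Definition nabla_cov3 h (t : V -> 'I_n -> 'I_n -> 'I_n -> R) x
    (l i j k : 'I_n) : R :=
  pd l (fun y => t y i j k) x
  - \sum_m (christoffel h x l i m * t x m j k)
  - \sum_m (christoffel h x l j m * t x i m k)
  - \sum_m (christoffel h x l k m * t x i j m).

Definition bracket v w x : V :=
  \row_k \sum_i (v x 0 i * pd i (fun y => w y 0 k) x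
                 - w x 0 i * pd i (fun y => v y 0 k) x).

Definition deriv_along v (f : V -> R) x : R := \sum_i v x 0 i * pd i f x.

(* Lie derivative along v of a bilinear form g^{ij} on covectors. *)
Definition lie_contra v (g : V -> 'M[R]_n) x : 'M[R]_n :=
  \matrix_(i, j) (deriv_along v (fun y => g y i j) x
    - \sum_k (g x k j * pd k (fun y => v y 0 i) x)
    - \sum_k (g x i k * pd k (fun y => v y 0 j) x)).

Definition form (A : 'M[R]_n) (u v : V) : R := \sum_i \sum_j A i j * u 0 i * v 0 j.

Definition tmul (c : 'I_n -> 'I_n -> 'I_n -> R) (u v : V) : V :=
  \row_k \sum_i \sum_j c i j k * u 0 i * v 0 j.

(* Bilinearity of the product and of the form is built into their being given
   by components. *)
Record frobenius_algebra (c : 'I_n -> 'I_n -> 'I_n -> R) (e : V)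
    (h : 'M[R]_n) : Prop := FrobeniusAlgebra {
  fa_comm : forall u v : V, tmul c u v = tmul c v u;
  fa_assoc : forall u v w : V, tmul c (tmul c u v) w = tmul c u (tmul c v w);
  fa_unit : forall u : V, tmul c e u = u;
  fa_sym : forall u v : V, form h u v = form h v u;
  fa_nondeg : forall u : V, (forall v : V, form h u v = 0) -> u = 0;
  fa_inv : forall u v w : V, form h (tmul c u v) w = form h u (tmul c v w) }.

End LocalCalculus.

(* A smooth n-manifold: Hausdorff, second countable, with a smooth atlas. The
   chart [a] is the homeomorphism [coord a] from [dom a] onto an open subset of
   R^n, with inverse [param a]; values elsewhere are irrelevant. *)
Record manifold (R : realType) (n : nat) := Manifold {
  point :> topologicalType;
  chart : Type;
  dom : chart -> set point;
  coord : chart -> point -> 'rV[R]_n;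
  param : chart -> 'rV[R]_n -> point;
  point_hausdorff : hausdorff_space point;
  point_second_countable : @second_countable point;
  dom_open : forall a, open (dom a);
  dom_cover : forall p, exists a, dom a p;
  coord_open : forall a, open (coord a @` dom a);
  coordK : forall a p, dom a p -> param a (coord a p) = p;
  coord_continuous : forall a, {within dom a, continuous (coord a)};
  param_continuous : forall a, {within coord a @` dom a, continuous (param a)};
  transition_smooth : forall a b (k : 'I_n),
    smooth_on (coord a @` (dom a `&` dom b))
      (fun x => coord b (param a x) 0 k) }.

Arguments dom {R n m}.
Arguments coord {R n m}.
Arguments param {R n m}.

Section Tensors.
Context {R : realType} {n : nat} (M : manifold R n).
Local Notation V := 'rV[R]_n.
Local Notation symbols := ('I_n -> 'I_n -> 'I_n -> R).

(* Component functions, in every chart, of a tensor or connection; only the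
   values at coordinates of points of the open set considered matter. *)
Definition components (X : Type) := chart M -> V -> X.

Definition patch (U : set M) (a : chart M) : set V := coord a @` (dom a `&` U).

(* (d x_b^k / d x_a^i)_{i k} *)
Definition jac (a b : chart M) (p : M) : 'M[R]_n :=
  jacobian (fun x => coord b (param a x)) (coord a p).

Definition smooth_function (U : set M) (f : M -> R) : Prop :=
  forall a, smooth_on (patch U a) (fun x => f (param a x)).

Definition vector_field (U : set M) (v : components V) : Prop :=
  (forall a k, smooth_on (patch U a) (fun x => v a x 0 k)) /\
  (forall a b p, U p -> dom a p -> dom b p ->
     v b (coord b p) = v a (coord a p) *m jac a b p).

Definition contra_tensor (U : set M) (g : components 'M[R]_n) : Prop :=
  (forall a i j, smooth_on (patch U a) (fun x => g a x i j)) /\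
  (forall a b p, U p -> dom a p -> dom b p ->
     g b (coord b p) = (jac a b p)^T *m g a (coord a p) *m jac a b p).

Definition cov_tensor (U : set M) (h : components 'M[R]_n) : Prop :=
  (forall a i j, smooth_on (patch U a) (fun x => h a x i j)) /\
  (forall a b p, U p -> dom a p -> dom b p ->
     h a (coord a p) = jac a b p *m h b (coord b p) *m (jac a b p)^T).

Definition product_tensor (U : set M) (c : components symbols) : Prop :=
  (forall a i j k, smooth_on (patch U a) (fun x => c a x i j k)) /\
  (forall a b p, U p -> dom a p -> dom b p -> forall i j r,
     \sum_m (c a (coord a p) i j m * jac a b p m r) =
     \sum_k \sum_l (jac a b p i k * jac a b p j l * c b (coord b p) k l r)).

Definition inverse (g : components 'M[R]_n) : components 'M[R]_n :=
  fun a x => invmx (g a x).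

Definition nondegenerate_locus (g : components 'M[R]_n) : set M :=
  [set p | forall a, dom a p -> g a (coord a p) \in unitmx].

Record contra_metric (g : components 'M[R]_n) : Prop := ContraMetric {
  cm_tensor : contra_tensor setT g;
  cm_sym : forall a x, patch setT a x -> (g a x)^T = g a x;
  cm_nondeg : exists U : set M,
    [/\ open U, dense U & U `<=` nondegenerate_locus g] }.

Record contra_levi_civita (g : components 'M[R]_n) (G : components symbols) :
    Prop := ContraLeviCivita {
  clc_smooth : forall a k i j,
    smooth_on (patch setT a) (fun x => G a x k i j);
  clc_def : forall a x, patch (nondegenerate_locus g) a x -> forall k i j,
    G a x k i j = - \sum_s (g a x i s * christoffel (inverse g a) x s k j) }.

Definition flat_cov_metric (U : set M) (h : components 'M[R]_n) : Prop :=
  forall a x, patch U a x -> forall i j k l, curvature (h a) x i j k l = 0.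

Definition flat_contra_metric (g : components 'M[R]_n) : Prop :=
  flat_cov_metric (nondegenerate_locus g) (inverse g).

Definition pencil (g1 g2 : components 'M[R]_n) (lambda : R) :
    components 'M[R]_n :=
  fun a x => g1 a x - lambda *: g2 a x.

Definition pencil_conn (G1 G2 : components symbols) (lambda : R) :
    components symbols :=
  fun a x k i j => G1 a x k i j - lambda * G2 a x k i j.

Record flat_pencil (g1 g2 : components 'M[R]_n) (G1 G2 : components symbols) :
    Prop := FlatPencil {
  fp_metric1 : contra_metric g1;
  fp_metric2 : contra_metric g2;
  fp_conn1 : contra_levi_civita g1 G1;
  fp_conn2 : contra_levi_civita g2 G2;
  fp_metric : forall lambda, contra_metric (pencil g1 g2 lambda);
  fp_conn : forall lambda,
    contra_levi_civita (pencil g1 g2 lambda) (pencil_conn G1 G2 lambda);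
  fp_flat : forall lambda, flat_contra_metric (pencil g1 g2 lambda) }.

Definition gradient (g : components 'M[R]_n) (tau : M -> R) : components V :=
  fun a x => \row_i \sum_s g a x i s * pd s (fun y => tau (param a y)) x.

Record quasihomogeneous (d : R) (g1 g2 : components 'M[R]_n) (tau : M -> R) :
    Prop := Quasihomogeneous {
  qh_smooth : smooth_function setT tau;
  qh_bracket : forall a x, patch setT a x ->
    bracket (gradient g2 tau a) (gradient g1 tau a) x = gradient g2 tau a x;
  qh_lie_E1 : forall a x, patch setT a x ->
    lie_contra (gradient g1 tau a) (g1 a) x = (d - 1) *: g1 a x;
  qh_lie_e1 : forall a x, patch setT a x ->
    lie_contra (gradient g2 tau a) (g1 a) x = g2 a x;
  qh_lie_e2 : forall a x, patch setT a x ->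
    lie_contra (gradient g2 tau a) (g2 a) x = 0 }.

(* The matrix (R_i^j)_{i j}. *)
Definition Rmx (d : R) (g2 : components 'M[R]_n) (E : components V) :
    components 'M[R]_n :=
  fun a x => \matrix_(i, j)
    ((d - 1) / 2 * (i == j)%:R + nabla (inverse g2 a) (E a) x i j).

Definition regular (d : R) (g2 : components 'M[R]_n) (E : components V) : Prop :=
  forall a x, patch (nondegenerate_locus g2) a x -> Rmx d g2 E a x \in unitmx.

(* R^{-1} v on covectors, where (R v)_i = R_i^j v_j. *)
Definition Rinv (d : R) (g2 : components 'M[R]_n) (E : components V) a x
    (v : V) : V :=
  \row_i \sum_j invmx (Rmx d g2 E a x) i j * v 0 j.

(* Delta^{ijk} *)
Definition Delta_up (g1 g2 : components 'M[R]_n) (G1 G2 : components symbols)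
    a x (i j k : 'I_n) : R :=
  \sum_s (g2 a x j s * G1 a x s i k - g1 a x i s * G2 a x s j k).

(* Delta(u, v)_k = u_i v_j Delta_k^{ij} *)
Definition Delta (g1 g2 : components 'M[R]_n) (G1 G2 : components symbols)
    a x (u v : V) : V :=
  \row_k \sum_i \sum_j u 0 i * v 0 j *
    \sum_s (inverse g2 a x k s * Delta_up g1 g2 G1 G2 a x s i j).

Record frobenius_data := FrobeniusData {
  fprod : components symbols;
  fmetric : components 'M[R]_n;
  funit : components V;
  feuler : components V }.

(* The four-linear form (nabla_z c)(u, v, w), c(u, v, w) = <u v, w>, as the
   components l i j k for z, u, v, w. *)
Definition nabla_c (F : frobenius_data) a x (l i j k : 'I_n) : R :=
  nabla_cov3 (fmetric F a)
    (fun y i j k => \sum_m fprod F a y i j m * fmetric F a y m k) x l i j k.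

Definition field_prod (F : frobenius_data) (v w : components V) : components V :=
  fun a x => tmul (fprod F a x) (v a x) (w a x).

(* Q = id + ad_E *)
Definition fQ (F : frobenius_data) (v : components V) : components V :=
  fun a x => v a x + bracket (feuler F a) (v a) x.

(* A Frobenius structure of charge d on the open submanifold U of M. *)
Record frobenius_structure (U : set M) (d : R) (F : frobenius_data) : Prop :=
    FrobeniusStructure {
  fs_open : open U;
  fs_prod : product_tensor U (fprod F);
  fs_metric : cov_tensor U (fmetric F);
  fs_unit : vector_field U (funit F);
  fs_euler : vector_field U (feuler F);
  fs_algebra : forall a x, patch U a x ->
    frobenius_algebra (fprod F a x) (funit F a x) (fmetric F a x);
  FM1_flat : flat_cov_metric U (fmetric F);
  FM1_unit : forall a x, patch U a x -> forall i j,
    nabla (fmetric F a) (funit F a) x i j = 0;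
  FM2 : forall a x, patch U a x -> forall l i j k,
    [/\ nabla_c F a x l i j k = nabla_c F a x i l j k,
        nabla_c F a x l i j k = nabla_c F a x l j i k &
        nabla_c F a x l i j k = nabla_c F a x l i k j];
  FM3_affine : forall a x, patch U a x -> forall i j k,
    nabla2 (fmetric F a) (feuler F a) x i j k = 0;
  FM3_prod : forall v w, vector_field U v -> vector_field U w ->
    forall a x, patch U a x ->
    fQ F (field_prod F v w) a x =
    field_prod F (fQ F v) w a x + field_prod F v (fQ F w) a x;
  FM3_metric : forall v w, vector_field U v -> vector_field U w ->
    forall a x, patch U a x ->
    deriv_along (feuler F a) (fun y => form (fmetric F a y) (v a y) (w a y)) x
    + d * form (fmetric F a x) (v a x) (w a x) =
    form (fmetric F a x) (fQ F v a x) (w a x)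
    + form (fmetric F a x) (v a x) (fQ F w a x) }.

(* Index raising and lowering with < , >, and the induced product of 1-forms. *)
Definition sharp (F : frobenius_data) a x (u : V) : V :=
  u *m invmx (fmetric F a x).
Definition flat (F : frobenius_data) a x (v : V) : V := v *m fmetric F a x.
Definition dual_prod (F : frobenius_data) a x (u v : V) : V :=
  flat F a x (tmul (fprod F a x) (sharp F a x u) (sharp F a x v)).

Definition intersection_form (F : frobenius_data) a x (u v : V) : R :=
  \sum_k feuler F a x 0 k * dual_prod F a x u v 0 k.

Definition eq_frobenius (U : set M) (F F' : frobenius_data) : Prop :=
  forall a x, patch U a x ->
  [/\ forall i j k, fprod F a x i j k = fprod F' a x i j k,
      fmetric F a x = fmetric F' a x,
      funit F a x = funit F' a x &
      feuler F a x = feuler F' a x].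

(* A Frobenius structure F on M_0 with < , > = ( , )_2, the product dual to
   u . v = Delta(u, R^{-1} v), unity e, Euler field E, and intersection form
   ( , )_1. *)
Record frobenius_of_pencil (d : R) (g1 g2 : components 'M[R]_n)
    (G1 G2 : components symbols) (E e : components V) (F : frobenius_data) :
    Prop := FrobeniusOfPencil {
  fop_structure : frobenius_structure (nondegenerate_locus g2) d F;
  fop_metric : forall a x, patch (nondegenerate_locus g2) a x ->
    invmx (fmetric F a x) = g2 a x;
  fop_prod : forall a x, patch (nondegenerate_locus g2) a x -> forall u v,
    dual_prod F a x u v = Delta g1 g2 G1 G2 a x u (Rinv d g2 E a x v);
  fop_unit : forall a x, patch (nondegenerate_locus g2) a x ->
    funit F a x = e a x;
  fop_euler : forall a x, patch (nondegenerate_locus g2) a x ->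
    feuler F a x = E a x;
  fop_intersection : forall a x, patch (nondegenerate_locus g2) a x ->
    forall u v, intersection_form F a x u v = form (g1 a x) u v }.

End Tensors.

(* Main.v *)
Require Import Defs.
From mathcomp Require Import all_boot all_order all_algebra.
From mathcomp Require Import all_classical all_reals all_analysis.
From mathcomp Require Import zify ring lra.

Set Implicit Arguments.
Unset Strict Implicit.
Unset Printing Implicit Defensive.

Import Order.TTheory GRing.Theory Num.Theory.
Import numFieldNormedType.Exports.

Local Open Scope classical_set_scope.
Local Open Scope ring_scope.
Import Defs.

(** Write [eta] and [g] for the contravariant metrics ( , )_2 and ( , )_1, and
    [Gam] for the Levi-Civita connection of [eta]. Instead of passing to flat
    coordinates of [eta], everything is done covariantly in an arbitrary chart.

    The tensor [Delta_k^{ij}] is the difference of the connections of the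
    pencil: if [a = g - l eta] is invertible, the connection of [a] is
    [Gam - a^{-1} Delta], with the same [Delta] for all [l]. Torsion-freeness,
    compatibility with [a] and flatness become polynomial in [l] once
    multiplied by [a]; as they hold for all but finitely many [l], one may
    compare coefficients (Section [DeltaTensor]). The result is that [Gam] is
    flat, that raising the index [k] of [Delta_k^{ij}] by [g] or [eta] makes
    the tensor symmetric in its first two indices, that
    [nabla_l Delta_k = nabla_k Delta_l], and that
    [Delta(Delta(u, v), z) = Delta(Delta(u, z), v)].

    Quasihomogeneity enters through the covector [dtau]. It is parallel, because
    the gradient [e] preserves [eta]. The equation for [L_E g] gives
    [Delta(u, dtau) = (1 - d)/2 u], first where [g] is invertible and then by
    density; differentiating [E = g dtau] then gives [Delta(dtau, v) = R v]. From
    [L_e g = eta] it follows that [R] and its adjoint add up to the identity, and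
    this together with the closedness of [Delta] forces [nabla R = 0]
    ([euler_op_parallel]).

    Now put [u.v = Delta(u, R^{-1} v)]. The covector [dtau] is a unit; the last
    identity for [Delta], contracted with [dtau], gives commutativity
    ([dual_sym]) and hence associativity ([mult_commute]); symmetry of [Delta]
    with indices raised by [eta] gives invariance of the metric, and by [g] the
    formula for the intersection form ([dual_E]). As [R] is parallel, the product
    inherits the closedness of [Delta], which is the potentiality axiom. For the
    same reason [E] is affine, and its homogeneity follows by trading
    [nabla_E (u.v)_i] for [nabla_i] of the product contracted with [E]
    ([lie_dual]). That the product is a tensor on the manifold comes from the
    transformation law of Christoffel symbols ([levi_civita_change]), whose
    inhomogeneous term cancels in [Delta]. A Frobenius structure with the
    required properties is determined by them, since the metric and the dual
    product determine the product of vectors. *)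

(** * Partial derivatives and smooth functions *)

Section PartialDerivatives.
Context {R : realType} {n : nat}.
Local Notation V := 'rV[R]_n.
Implicit Types (f g : V -> R) (x : V) (A : set V).

Lemma differentiable_near_eq f g x :
  (\near x, f x = g x) -> differentiable f x -> differentiable g x.
Proof.
move=> fg /diff_locallyP [cf ef].
have fxgx : f x = g x by exact: (nbhs_singleton fg).
have eg : g \o shift x = cst (g x) + 'd f x +o_ (0 : V) id.
  apply/eqaddoP => e e0.
  move/eqaddoP: ef => /(_ e e0) H.
  move: fg; rewrite (near_shift 0 x) => fg.
  near=> h.
  have fgh : f (h + x) = g (h + x).
    have : ((fun z => f z = g z) \o shift (x - 0)) h by near: h.
    by rewrite /= subr0.
  have : `|(f \o shift x - (cst (f x) + 'd f x)) h| <= e * `|id h|.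
    by near: h; exact: H.
  by rewrite !fctE /= fgh fxgx.
have dgf : 'd g x = 'd f x :> (V -> R) by apply: diff_unique.
by apply/diff_locallyP; rewrite dgf.
Unshelve. all: by end_near. Qed.

Lemma pd_near_eq i f g x : (\near x, f x = g x) -> pd i f x = pd i g x.
Proof. exact: near_eq_derive. Qed.

Lemma pd_eq_on A i f g x :
  open A -> A x -> (forall y, A y -> f y = g y) -> pd i f x = pd i g x.
Proof.
move=> oA Ax fg; apply: pd_near_eq.
have : nbhs x A by exact: open_nbhs_nbhs.
by apply: filterS.
Qed.

Lemma pd_cst i (c : R) x : pd i (fun=> c) x = 0.
Proof. exact: derive_cst. Qed.

Lemma pdD i f g x : differentiable f x -> differentiable g x ->
  pd i (fun y => f y + g y) x = pd i f x + pd i g x.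
Proof. by move=> df dg; rewrite /pd [LHS]deriveD //; exact: diff_derivable. Qed.

Lemma pdN i f x : differentiable f x -> pd i (fun y => - f y) x = - pd i f x.
Proof. by move=> df; rewrite /pd [LHS]deriveN //; exact: diff_derivable. Qed.

Lemma pdM i f g x : differentiable f x -> differentiable g x ->
  pd i (fun y => f y * g y) x = pd i f x * g x + f x * pd i g x.
Proof.
move=> df dg; rewrite /pd [LHS]deriveM; try exact: diff_derivable.
by rewrite addrC; congr (_ + _); rewrite /GRing.scale /= mulrC.
Qed.

Lemma pdV i f x : differentiable f x -> f x != 0 ->
  pd i (fun y => (f y)^-1) x = - ((f x)^-1 * (f x)^-1) * pd i f x.
Proof.
move=> df f0; rewrite /pd [LHS]deriveV //; last exact: diff_derivable.
by rewrite /GRing.scale /= -exprVn expr2.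
Qed.

Lemma differentiable_fsum (I : Type) (r : seq I) (P : pred I)
    (F : I -> V -> R) x :
  (forall i, P i -> differentiable (F i) x) ->
  differentiable (fun y => \sum_(i <- r | P i) F i y) x.
Proof.
move=> dF; elim: r => [|a r IH].
  by under eq_fun do rewrite big_nil; exact: differentiable_cst.
under eq_fun do rewrite big_cons.
case Pa: (P a) => //; apply: differentiableD => //; exact: dF.
Qed.

Lemma pd_sum i (I : Type) (r : seq I) (P : pred I) (F : I -> V -> R) x :
  (forall k, P k -> differentiable (F k) x) ->
  pd i (fun y => \sum_(k <- r | P k) F k y) x = \sum_(k <- r | P k) pd i (F k) x.
Proof.
move=> dF; elim: r => [|a r IH].
  by rewrite big_nil -[RHS](pd_cst i 0 x); congr pd; apply/funext=> y; rewrite big_nil.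
rewrite big_cons -IH; case Pa: (P a).
  rewrite -pdD; [|exact: dF|exact: differentiable_fsum].
  by congr pd; apply/funext=> y; rewrite big_cons Pa.
by congr pd; apply/funext=> y; rewrite big_cons Pa.
Qed.

(** Finitely often differentiable functions: closure properties of
    [smooth_on] are proved by induction on the order of differentiation. *)
Fixpoint Ck (k : nat) A f : Prop :=
  (forall x, A x -> differentiable f x) /\
  (if k is k'.+1 then forall i, Ck k' A (pd i f) else True).

Lemma Ck_diff k A f x : Ck k A f -> A x -> differentiable f x.
Proof. by case: k => [|k] [H _] Ax; exact: H. Qed.

Lemma Ck_pred k A f : Ck k.+1 A f -> Ck k A f.
Proof.
elim: k f => [|k IH] f [H1 H2]; split=> // i; exact/IH/H2.
Qed.

Lemma smooth_onP A f : smooth_on A f <-> forall k, Ck k A f.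
Proof.
split=> [sf k|Cf s].
  elim: k f sf => [|k IH] f sf; split=> //; try exact: (sf [::]).
  by move=> i; apply: IH => s x Ax; have := sf (rcons s i) x Ax; rewrite foldr_rcons.
elim/last_ind: s f Cf => [|s i IH] f Cf x Ax; first exact: (Ck_diff (Cf 0)).
by rewrite foldr_rcons; apply: IH => // k; have [_] := Cf k.+1; apply.
Qed.

Lemma smooth_on_diff A f x : smooth_on A f -> A x -> differentiable f x.
Proof. by move=> sf; exact: (sf [::]). Qed.

Lemma smooth_on_pd A f i : smooth_on A f -> smooth_on A (pd i f).
Proof. by move=> /smooth_onP sf; apply/smooth_onP=> k; have [_] := sf k.+1; apply. Qed.

Lemma smooth_onS A B f : A `<=` B -> smooth_on B f -> smooth_on A f.
Proof. by move=> AB sf s x /AB; exact: sf. Qed.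

Section OpenSet.
Context (A : set V) (oA : open A).

Lemma near_eq_on f g x :
  A x -> (forall y, A y -> f y = g y) -> \near x, f x = g x.
Proof.
by move=> Ax fg; have : nbhs x A by [exact: open_nbhs_nbhs]; apply: filterS.
Qed.

Lemma Ck_eq k f g : (forall x, A x -> f x = g x) -> Ck k A f -> Ck k A g.
Proof.
elim: k f g => [|k IH] f g fg [H1 H2]; split=> //.
- by move=> x Ax; apply: differentiable_near_eq (H1 _ Ax); exact: near_eq_on.
- by move=> x Ax; apply: differentiable_near_eq (H1 _ Ax); exact: near_eq_on.
- move=> i; apply: (IH (pd i f)); last exact: H2.
  by move=> x Ax; apply: pd_eq_on fg.
Qed.

Lemma Ck_cst k c : Ck k A (fun=> c).
Proof.
elim: k c => [|k IH] c; split=> //; try by move=> x _; exact: differentiable_cst.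
by move=> i; apply: Ck_eq (IH 0) => x _; rewrite pd_cst.
Qed.

Lemma CkD k f g : Ck k A f -> Ck k A g -> Ck k A (fun x => f x + g x).
Proof.
elim: k f g => [|k IH] f g [f1 f2] [g1 g2]; split=> //.
- by move=> x Ax; apply: differentiableD; [exact: f1|exact: g1].
- by move=> x Ax; apply: differentiableD; [exact: f1|exact: g1].
- move=> i; apply: Ck_eq (IH _ _ (f2 i) (g2 i)) => x Ax.
  by rewrite pdD //; [exact: f1|exact: g1].
Qed.

Lemma CkM k f g : Ck k A f -> Ck k A g -> Ck k A (fun x => f x * g x).
Proof.
elim: k f g => [|k IH] f g Cf Cg.
  have [f1 _] := Cf; have [g1 _] := Cg; split=> // x Ax.
  by apply: differentiableM; [exact: f1|exact: g1].
have Cf' := Ck_pred Cf; have Cg' := Ck_pred Cg.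
have [f1 f2] := Cf; have [g1 g2] := Cg; split=> [x Ax|i].
  by apply: differentiableM; [exact: f1|exact: g1].
apply: Ck_eq (CkD (IH _ _ (f2 i) Cg') (IH _ _ Cf' (g2 i))) => x Ax.
by rewrite pdM //; [exact: f1|exact: g1].
Qed.

Lemma CkV k f : (forall x, A x -> f x != 0) -> Ck k A f ->
  Ck k A (fun x => (f x)^-1).
Proof.
move=> f0; elim: k f f0 => [|k IH] f f0 Cf.
  have [f1 _] := Cf; split=> // x Ax.
  by apply: differentiableV; [exact: f1|exact: f0].
have Cf' := IH _ f0 (Ck_pred Cf).
have [f1 f2] := Cf; split=> [x Ax|i].
  by apply: differentiableV; [exact: f1|exact: f0].
have H := CkM (CkM (Ck_cst k (-1)) (CkM Cf' Cf')) (f2 i).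
apply: Ck_eq H => x Ax.
by rewrite pdV ?mulN1r //; [exact: f1|exact: f0].
Qed.

Lemma smooth_on_eq f g :
  (forall x, A x -> f x = g x) -> smooth_on A f -> smooth_on A g.
Proof. by move=> fg /smooth_onP Cf; apply/smooth_onP => k; exact: Ck_eq (Cf k). Qed.

Lemma smooth_on_cst c : smooth_on A (fun=> c).
Proof. by apply/smooth_onP => k; exact: Ck_cst. Qed.

Lemma smooth_onD f g :
  smooth_on A f -> smooth_on A g -> smooth_on A (fun x => f x + g x).
Proof. by move=> /smooth_onP Cf /smooth_onP Cg; apply/smooth_onP => k; exact: CkD. Qed.

Lemma smooth_onM f g :
  smooth_on A f -> smooth_on A g -> smooth_on A (fun x => f x * g x).
Proof. by move=> /smooth_onP Cf /smooth_onP Cg; apply/smooth_onP => k; exact: CkM. Qed.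

Lemma smooth_onV f : (forall x, A x -> f x != 0) ->
  smooth_on A f -> smooth_on A (fun x => (f x)^-1).
Proof. by move=> f0 /smooth_onP Cf; apply/smooth_onP => k; exact: CkV. Qed.

Lemma smooth_onN f : smooth_on A f -> smooth_on A (fun x => - f x).
Proof.
move=> sf; apply: smooth_on_eq (smooth_onM (smooth_on_cst (-1)) sf) => x _.
by rewrite mulN1r.
Qed.

Lemma smooth_on_sum (I : Type) (r : seq I) (P : pred I) (F : I -> V -> R) :
  (forall i, P i -> smooth_on A (F i)) ->
  smooth_on A (fun x => \sum_(i <- r | P i) F i x).
Proof.
move=> sF; elim: r => [|a r IH].
  by apply: smooth_on_eq (smooth_on_cst 0) => x _; rewrite big_nil.
case Pa: (P a); last by apply: smooth_on_eq IH => x _; rewrite big_cons Pa.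
by apply: smooth_on_eq (smooth_onD (sF _ Pa) IH) => x _; rewrite big_cons Pa.
Qed.

Lemma smooth_on_prod (I : Type) (r : seq I) (P : pred I) (F : I -> V -> R) :
  (forall i, P i -> smooth_on A (F i)) ->
  smooth_on A (fun x => \prod_(i <- r | P i) F i x).
Proof.
move=> sF; elim: r => [|a r IH].
  by apply: smooth_on_eq (smooth_on_cst 1) => x _; rewrite big_nil.
case Pa: (P a); last by apply: smooth_on_eq IH => x _; rewrite big_cons Pa.
by apply: smooth_on_eq (smooth_onM (sF _ Pa) IH) => x _; rewrite big_cons Pa.
Qed.

End OpenSet.

End PartialDerivatives.

(** ** Chain rule and symmetry of second derivatives *)

Section ChainRule.
Context {R : realType} {n : nat}.
Local Notation V := 'rV[R]_n.
Implicit Types (f : V -> R) (phi : V -> V) (x : V).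

Lemma differentiable_row phi x :
  (forall k, differentiable (fun y => phi y 0 k) x) -> differentiable phi x.
Proof.
move=> dphi.
have -> : phi = \sum_(k < n) (fun y => phi y 0 k *: delta_mx 0 k).
  by apply/funext => y; rewrite fct_sumE [LHS]row_sum_delta.
by apply: differentiable_sum => k; apply: differentiableZl.
Qed.

Lemma jacobianE phi x i k :
  (forall k, differentiable (fun y => phi y 0 k) x) ->
  jacobian phi x i k = pd i (fun y => phi y 0 k) x.
Proof.
move=> dphi; have dp := differentiable_row dphi.
have := deriveEjacobian (delta_mx 0 i) dp.
rewrite derive_mx; last exact: diff_derivable.
by rewrite -rowE => /(congr1 (fun r : V => r 0 k)); rewrite !mxE.
Qed.

Lemma pd_comp i f phi x :
  (forall k, differentiable (fun y => phi y 0 k) x) ->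
  differentiable f (phi x) ->
  pd i (fun y => f (phi y)) x =
  \sum_k pd i (fun y => phi y 0 k) x * pd k f (phi x).
Proof.
move=> dphi df; have dp := differentiable_row dphi.
rewrite /pd (_ : (fun y => f (phi y)) = f \o phi) // deriveE; last first.
  exact: (differentiable_comp dp df).
rewrite diff_comp // [LHS]/= -(deriveE _ dp) derive_mx; last exact: diff_derivable.
rewrite [X in 'd f _ X]row_sum_delta linear_sum; apply: eq_bigr => k _.
by rewrite -[LHS]/('d f (phi x) (_ *: _)) linearZ -(deriveE _ df) mxE.
Qed.

End ChainRule.

Section Schwarz.
Context {R : realType} {n : nat}.
Local Notation V := 'rV[R]_n.
Implicit Types (f : V -> R) (x u v : V) (A : set V).

Lemma is_derive_line f z u t : derivable f (t *: u + z) u ->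
  is_derive t 1 (fun s : R => f (s *: u + z)) ('D_u f (t *: u + z)).
Proof.
move=> df.
have E : (fun h : R => h^-1 *: ((fun s : R => f (s *: u + z)) (h *: 1 + t) -
            (fun s : R => f (s *: u + z)) t)) =
         (fun h : R => h^-1 *: (f (h *: u + (t *: u + z)) - f (t *: u + z))).
  apply/funext => h; congr (_ *: (f _ - _)).
  by rewrite scalerDl addrA /GRing.scale /= mulr1.
by apply: DeriveDef; [rewrite /derivable E|rewrite /derive E].
Qed.

(** The second difference quotient of [f] in the directions [u], [v] is, by the
    mean value theorem along [u], an increment along [v] of the derivative of
    [f] along [u]. *)
Lemma second_difference A f x u v (e : R) :
  open A -> A x -> (forall y, A y -> differentiable f y) ->
  differentiable ('D_u f) x -> 0 < e ->
  exists2 r : R, 0 < r & forall h : R, 0 < h -> h < r ->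
    `|f (x + h *: u + h *: v) - f (x + h *: u) - f (x + h *: v) + f x
      - h * h * 'D_v ('D_u f) x| <= e * (h * h).
Proof.
move=> oA Ax df dF e0.
set F := 'D_u f.
pose N := `|u| + `|v| + 1.
have N0 : 0 < N by rewrite ltr_wpDl // addr_ge0.
have [r1 r10 r1A] : exists2 r : R, 0 < r & forall y, `|y - x| < r -> A y.
  have /nbhs_ballP [r /= r0 rA] : nbhs x A by exact: open_nbhs_nbhs.
  by exists r => // y yx; apply: rA; rewrite -ball_normE /= distrC.
have e'0 : 0 < e / (N + N) by rewrite divr_gt0 // addr_gt0.
have [r2 r20 r2F] : exists2 r : R, 0 < r & forall k : V, `|k| < r ->
    `|F (k + x) - (F x + 'd F x k)| <= e / (N + N) * `|k|.
  have /eqaddoP /(_ _ e'0) := diff_locally dF.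
  move=> /nbhs_ballP [r /= r0 rF].
  exists r => // k kr; apply: (rF k).
  by rewrite -ball_normE /= sub0r normrN.
exists (Num.min r1 r2 / N); first by rewrite divr_gt0 // lt_min r10.
move=> h h0; rewrite ltr_pdivlMr // lt_min => /andP [hr1 hr2].
have nrm (c : R) : 0 <= c -> c <= h ->
    `|c *: u| <= h * N /\ `|c *: u + h *: v| <= h * N.
  move=> c0 ch; rewrite normrZ (ger0_norm c0).
  have H1 : c * `|u| <= h * `|u| by rewrite ler_wpM2r.
  have H3 : h * N = h * `|u| + h * `|v| + h by rewrite /N !mulrDr mulr1.
  have H4 : 0 <= h * `|u| by rewrite mulr_ge0 // ltW.
  have H5 : 0 <= h * `|v| by rewrite mulr_ge0 // ltW.
  split; first by rewrite H3; lra.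
  apply: (le_trans (ler_normD _ _)); rewrite !normrZ (ger0_norm c0) (gtr0_norm h0).
  by rewrite H3; lra.
have inA (c : R) : 0 <= c -> c <= h -> A (c *: u + x) /\ A (c *: u + (x + h *: v)).
  move=> c0 ch; have [H1 H2] := nrm c c0 ch; split; apply: r1A.
    by rewrite addrK (le_lt_trans H1).
  by rewrite (addrC x) addrA addrK (le_lt_trans H2).
pose p (t : R) := f (t *: u + (x + h *: v)) - f (t *: u + x).
pose dp (t : R) := F (t *: u + (x + h *: v)) - F (t *: u + x).
have Hd (t : R) : 0 <= t -> t <= h -> is_derive t 1 p (dp t).
  move=> t0 th; have [H1 H2] := inA t t0 th.
  have d1 : is_derive t 1 (fun s => f (s *: u + (x + h *: v)))
                          (F (t *: u + (x + h *: v))).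
    by apply: is_derive_line; apply: diff_derivable; exact: df.
  have d2 : is_derive t 1 (fun s => f (s *: u + x)) (F (t *: u + x)).
    by apply: is_derive_line; apply: diff_derivable; exact: df.
  exact: is_deriveB.
have [||c] := @MVT R p dp 0 h h0.
- by move=> t /itvP tI; apply: Hd; rewrite tI.
- apply: derivable_within_continuous => t /itvP tI.
  by have [] := Hd t _ _; rewrite ?tI.
move=> /itvP cI; rewrite subr0 {1 2}/p => pE.
have c0 : 0 <= c by rewrite cI.
have ch : c <= h by rewrite cI.
have [n1 n2] := nrm c c0 ch.
have -> : f (x + h *: u + h *: v) - f (x + h *: u) - f (x + h *: v) + f x
   = dp c * h.
  rewrite -pE !scale0r !add0r addrCA addrA (addrC (h *: u) x); ring.
have F1 := r2F _ (le_lt_trans n1 hr2).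
have F2 := r2F _ (le_lt_trans n2 hr2).
have -> : dp c * h - h * h * 'D_v F x
  = h * ((F (c *: u + h *: v + x) - (F x + 'd F x (c *: u + h *: v)))
         - (F (c *: u + x) - (F x + 'd F x (c *: u)))).
  have dE : 'd F x (c *: u + h *: v) = 'd F x (c *: u) + h * 'd F x v.
    by rewrite linearD; congr (_ + _); exact: linearZ.
  rewrite /dp dE (deriveE v dF) (addrC x) addrA; ring.
rewrite normrM (gtr0_norm h0) mulrCA ler_pM2l //.
apply: (le_trans (ler_normB _ _)).
apply: (le_trans (lerD F2 F1)).
have -> : e * h = e / (N + N) * (h * N) + e / (N + N) * (h * N).
  by rewrite -mulrDr -mulrDr (mulrC h) mulrA divfK // gt_eqF // addr_gt0.
by apply: lerD; rewrite ler_pM2l.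
Qed.

Lemma squeeze_scaled (S s P Q e : R) : 0 < s ->
  `|S - s * P| <= e * s -> `|S - s * Q| <= e * s -> `|P - Q| <= e + e.
Proof.
move=> s0 /ler_normlP [L1 U1] /ler_normlP [L2 U2].
by apply/ler_normlP; split; rewrite -(ler_pM2l s0); lra.
Qed.

(** The second difference does not depend on the order of the two directions. *)
Lemma derive_swap A f x u v :
  open A -> A x -> (forall y, A y -> differentiable f y) ->
  differentiable ('D_u f) x -> differentiable ('D_v f) x ->
  'D_v ('D_u f) x = 'D_u ('D_v f) x.
Proof.
move=> oA Ax df du dv; apply/eqP; rewrite -subr_eq0 -normr_eq0.
apply/negPn/negP => d0; set d := `|_| in d0.
have {}d0 : 0 < d by rewrite lt_neqAle eq_sym d0 normr_ge0.
have e0 : 0 < d / 3 by rewrite divr_gt0.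
have [r1 r10 H1] := second_difference v oA Ax df du e0.
have [r2 r20 H2] := second_difference u oA Ax df dv e0.
pose h := Num.min r1 r2 / 2.
have m0 : 0 < Num.min r1 r2 by rewrite lt_min r10.
have h0 : 0 < h by rewrite divr_gt0.
have hm : h < Num.min r1 r2 by rewrite /h ltr_pdivrMr // mulr_natr mulr2n ltrDl.
move: hm; rewrite lt_min => /andP [h1 h2].
move: (H1 h h0 h1) (H2 h h0 h2).
rewrite (addrAC x (h *: v)) (addrAC (f _) (- f (x + h *: v))).
move: (f _ - f _ - f _ + f x) (h * h) (mulr_gt0 h0 h0) => S hh hh0.
move=> K1 K2; have := squeeze_scaled hh0 K1 K2.
by rewrite -/d; move: d0; clear; clearbody d; lra.
Qed.

Lemma pd_swap A f x i j : open A -> A x -> smooth_on A f ->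
  pd i (pd j f) x = pd j (pd i f) x.
Proof.
move=> oA Ax sf; apply: (derive_swap oA Ax).
- by move=> y Ay; exact: smooth_on_diff Ay.
- by apply: (@smooth_on_diff _ _ A) => //; exact: smooth_on_pd.
- by apply: (@smooth_on_diff _ _ A) => //; exact: smooth_on_pd.
Qed.

End Schwarz.

(** * Matrix-valued functions *)

Lemma addmxE (R : zmodType) m n (A B : 'M[R]_(m, n)) i j :
  (A + B) i j = A i j + B i j.
Proof. by rewrite mxE. Qed.

Lemma oppmxE (R : zmodType) m n (A : 'M[R]_(m, n)) i j : (- A) i j = - A i j.
Proof. by rewrite mxE. Qed.

Lemma scalemxE (R : nzRingType) m n c (A : 'M[R]_(m, n)) i j : (c *: A) i j = c * A i j.
Proof. by rewrite mxE. Qed.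

Lemma trmxD (R : zmodType) m n (A B : 'M[R]_(m, n)) : (A + B)^T = A^T + B^T.
Proof. by apply/matrixP => i j; rewrite !mxE. Qed.

Lemma trmxN (R : zmodType) m n (A : 'M[R]_(m, n)) : (- A)^T = - A^T.
Proof. by apply/matrixP => i j; rewrite !mxE. Qed.

Section MatrixCalculus.
Context {R : realType} {n : nat}.
Local Notation V := 'rV[R]_n.
Implicit Types (x : V) (A : set V).

Definition mdiff p q (F : V -> 'M[R]_(p, q)) x :=
  forall i j, differentiable (fun y => F y i j) x.

Definition msmooth A p q (F : V -> 'M[R]_(p, q)) :=
  forall i j, smooth_on A (fun y => F y i j).

Fact pdm_key : unit. Proof. exact: tt. Qed.

(** Locked, so that conversion never compares derivatives by unfolding them to
    limits. *)
Definition pdm : forall (k : 'I_n) p q (F : V -> 'M[R]_(p, q)) x, 'M[R]_(p, q) :=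
  locked_with pdm_key
    (fun k p q F x => \matrix_(i, j) pd k (fun y => F y i j) x).
Arguments pdm k [p q] F x.

Lemma pdmE k p q (F : V -> 'M[R]_(p, q)) x i j :
  pdm k F x i j = pd k (fun y => F y i j) x.
Proof. by rewrite /pdm unlock mxE. Qed.

Lemma msmooth_mdiff A p q (F : V -> 'M[R]_(p, q)) x :
  msmooth A F -> A x -> mdiff F x.
Proof. by move=> sF Ax i j; exact: smooth_on_diff Ax. Qed.

Lemma mdiffM p q r (F : V -> 'M[R]_(p, q)) (G : V -> 'M[R]_(q, r)) x :
  mdiff F x -> mdiff G x -> mdiff (fun y => F y *m G y) x.
Proof.
move=> dF dG i j; under eq_fun do rewrite mxE.
by apply: differentiable_fsum => k _; apply: differentiableM.
Qed.

Lemma pdmM k p q r (F : V -> 'M[R]_(p, q)) (G : V -> 'M[R]_(q, r)) x :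
  mdiff F x -> mdiff G x ->
  pdm k (fun y => F y *m G y) x = pdm k F x *m G x + F x *m pdm k G x.
Proof.
move=> dF dG; apply/matrixP => i j; rewrite pdmE addmxE !mxE.
under eq_fun do rewrite mxE.
rewrite pd_sum; last by move=> s _; apply: differentiableM.
rewrite -big_split; apply: eq_bigr => s _ /=.
by rewrite pdM // -!pdmE.
Qed.

Lemma pdmD k p q (F G : V -> 'M[R]_(p, q)) x : mdiff F x -> mdiff G x ->
  pdm k (fun y => F y + G y) x = pdm k F x + pdm k G x.
Proof.
move=> dF dG; apply/matrixP => i j; rewrite addmxE !pdmE.
by under eq_fun do rewrite mxE; rewrite pdD.
Qed.

Lemma pdmN k p q (F : V -> 'M[R]_(p, q)) x : mdiff F x ->
  pdm k (fun y => - F y) x = - pdm k F x.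
Proof.
move=> dF; apply/matrixP => i j; rewrite oppmxE !pdmE.
by under eq_fun do rewrite mxE; rewrite pdN.
Qed.

Lemma pdmT k p q (F : V -> 'M[R]_(p, q)) x :
  pdm k (fun y => (F y)^T) x = (pdm k F x)^T.
Proof.
apply/matrixP => i j; rewrite mxE !pdmE.
by congr pd; apply/funext => y; rewrite mxE.
Qed.

Lemma pdm_cst k p q (M : 'M[R]_(p, q)) x : pdm k (fun=> M) x = 0.
Proof. by apply/matrixP => i j; rewrite pdmE pd_cst mxE. Qed.

Lemma mdiff_cst p q (M : 'M[R]_(p, q)) x : mdiff (fun=> M) x.
Proof. by move=> i j; exact: differentiable_cst. Qed.

Lemma mdiffT p q (F : V -> 'M[R]_(p, q)) x : mdiff F x -> mdiff (fun y => (F y)^T) x.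
Proof. by move=> dF i j; under eq_fun do rewrite mxE. Qed.

Lemma mdiffN p q (F : V -> 'M[R]_(p, q)) x : mdiff F x -> mdiff (fun y => - F y) x.
Proof. by move=> dF i j; under eq_fun do rewrite mxE; exact: differentiableN. Qed.

Lemma pdm_eq_on k A p q (F G : V -> 'M[R]_(p, q)) x :
  open A -> A x -> (forall y, A y -> F y = G y) -> pdm k F x = pdm k G x.
Proof.
move=> oA Ax FG; apply/matrixP => i j; rewrite !pdmE.
by apply: (pd_eq_on _ oA Ax) => y Ay; rewrite FG.
Qed.

Section OpenSet.
Context (A : set V) (oA : open A).

Lemma msmooth_eq p q (F G : V -> 'M[R]_(p, q)) :
  (forall x, A x -> F x = G x) -> msmooth A F -> msmooth A G.
Proof.
by move=> FG sF i j; apply: (smooth_on_eq oA) (sF i j) => x Ax; rewrite FG.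
Qed.

Lemma msmoothM p q r (F : V -> 'M[R]_(p, q)) (G : V -> 'M[R]_(q, r)) :
  msmooth A F -> msmooth A G -> msmooth A (fun y => F y *m G y).
Proof.
move=> sF sG i j; under eq_fun do rewrite mxE.
by apply: smooth_on_sum => // k _; apply: smooth_onM.
Qed.

Lemma msmoothD p q (F G : V -> 'M[R]_(p, q)) :
  msmooth A F -> msmooth A G -> msmooth A (fun y => F y + G y).
Proof. by move=> sF sG i j; under eq_fun do rewrite mxE; exact: smooth_onD. Qed.

Lemma msmoothN p q (F : V -> 'M[R]_(p, q)) :
  msmooth A F -> msmooth A (fun y => - F y).
Proof. by move=> sF i j; under eq_fun do rewrite mxE; exact: smooth_onN. Qed.

Lemma msmoothZ p q c (F : V -> 'M[R]_(p, q)) :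
  msmooth A F -> msmooth A (fun y => c *: F y).
Proof.
move=> sF i j; under eq_fun do rewrite mxE.
by apply: smooth_onM => //; exact: smooth_on_cst.
Qed.

Lemma msmoothT p q (F : V -> 'M[R]_(p, q)) :
  msmooth A F -> msmooth A (fun y => (F y)^T).
Proof. by move=> sF i j; under eq_fun do rewrite mxE; exact: sF. Qed.

Lemma smooth_on_det m (F : V -> 'M[R]_m) :
  msmooth A F -> smooth_on A (fun y => \det (F y)).
Proof.
move=> sF; rewrite /determinant; apply: smooth_on_sum => // s _.
apply: smooth_onM => //; first exact: smooth_on_cst.
by apply: smooth_on_prod.
Qed.

Lemma msmoothV m (F : V -> 'M[R]_m) : (forall x, A x -> F x \in unitmx) ->
  msmooth A F -> msmooth A (fun y => invmx (F y)).
Proof.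
move=> uF sF i j.
apply: (@smooth_on_eq _ _ _ oA (fun x => (\det (F x))^-1 * cofactor (F x) j i)).
  by move=> x Ax; rewrite /invmx uF // !mxE.
apply: smooth_onM => //.
  apply: smooth_onV => //; last exact: smooth_on_det.
  by move=> x /uF; rewrite unitmxE unitfE.
apply: smooth_onM => //; first exact: smooth_on_cst.
apply: smooth_on_det => a b.
by under eq_fun do rewrite !mxE; exact: sF.
Qed.

Lemma pdmV k m (F : V -> 'M[R]_m) x : (forall x, A x -> F x \in unitmx) ->
  msmooth A F -> A x ->
  pdm k (fun y => invmx (F y)) x = - (invmx (F x) *m pdm k F x *m invmx (F x)).
Proof.
move=> uF sF Ax.
have sV := msmoothV uF sF.
have /eqP : pdm k (fun y => F y *m invmx (F y)) x = 0.
  rewrite -(pdm_cst k (1%:M : 'M[R]_m) x); apply: (pdm_eq_on _ oA Ax) => y Ay.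
  by rewrite mulmxV // uF.
rewrite pdmM; [|exact: msmooth_mdiff Ax|exact: msmooth_mdiff Ax].
rewrite addrC addr_eq0 => /eqP E.
by rewrite -[LHS](mulKmx (uF x Ax)) E mulmxN !mulmxA.
Qed.

(** The determinant is continuous. *)
Lemma open_unitmx m (F : V -> 'M[R]_m) : msmooth A F ->
  open [set x | A x /\ F x \in unitmx].
Proof.
move=> sF.
have -> : [set x | A x /\ F x \in unitmx] = [set x | A x /\ \det (F x) != 0].
  by apply/seteqP; split=> x /= [Ax]; rewrite unitmxE unitfE => H.
rewrite openE => x [Ax dx]; rewrite /interior.
have /differentiable_continuous cd : differentiable (fun y => \det (F y)) x.
  by apply: smooth_on_diff Ax; exact: smooth_on_det.
have H1 : \forall y \near x, \det (F y) != 0.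
  apply: (cd [set z : R | z != 0]); apply: open_nbhs_nbhs.
  by split; [exact: open_neq|exact: dx].
have H2 : nbhs x A by exact: open_nbhs_nbhs.
by near=> y; split; near: y.
Unshelve. all: by end_near. Qed.

End OpenSet.

End MatrixCalculus.

(** * The Levi-Civita connection in matrix form *)

Section LeviCivita.
Context {R : realType} {n : nat}.
Local Notation V := 'rV[R]_n.
Implicit Types (h : V -> 'M[R]_n) (x : V) (A : set V) (G : 'I_n -> 'M[R]_n).

Fact levi_civita_key : unit. Proof. exact: tt. Qed.

Definition levi_civita : (V -> 'M[R]_n) -> V -> 'I_n -> 'M[R]_n :=
  locked_with levi_civita_key (fun h x k => \matrix_(i, j) christoffel h x k i j).

Lemma levi_civitaE h x k i j : levi_civita h x k i j = christoffel h x k i j.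
Proof. by rewrite /levi_civita unlock mxE. Qed.

Definition torsion_free G := forall k i j, G k i j = G i k j.

Lemma invmx_sym (H : 'M[R]_n) : H^T = H -> (invmx H)^T = invmx H.
Proof. by rewrite trmx_inv => ->. Qed.

Lemma mx_sym (H : 'M[R]_n) : (forall i j, H i j = H j i) <-> H^T = H.
Proof.
split=> [sH|sH i j]; first by apply/matrixP => i j; rewrite mxE.
by rewrite -{1}sH mxE.
Qed.

Lemma levi_civita_koszul h x k i j : h x \in unitmx -> (h x)^T = h x ->
  (levi_civita h x k *m h x) i j =
  2^-1 * (pdm k h x j i + pdm i h x j k - pdm j h x k i).
Proof.
move=> uh sh; rewrite mxE.
under eq_bigr do rewrite levi_civitaE /christoffel -mulrA.
rewrite -mulr_sumr; congr (_ * _).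
under eq_bigr do rewrite mulr_suml.
have ihE l : \sum_m invmx (h x) m l * h x m j = (l == j)%:R.
  have := congr1 (fun M : 'M[R]_n => M l j) (mulVmx uh); rewrite [RHS]mxE => <-.
  rewrite mxE; apply: eq_bigr => m _; congr (_ * _).
  exact: (mx_sym _).2 (invmx_sym sh) m l.
rewrite exchange_big /= (bigD1 j) //= [X in _ + X]big1 => [|l lj].
  under eq_bigr do rewrite mulrAC.
  by rewrite -mulr_suml addr0 ihE eqxx mul1r !pdmE.
under eq_bigr do rewrite mulrAC.
by rewrite -mulr_suml ihE (negbTE lj) mul0r.
Qed.

Lemma pdm_sym A h x k : open A -> A x -> (forall y, A y -> (h y)^T = h y) ->
  (pdm k h x)^T = pdm k h x.
Proof. by move=> oA Ax sh; rewrite -pdmT; exact: (pdm_eq_on _ oA Ax). Qed.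

Lemma levi_civita_torsion_free A h x : open A -> A x ->
  (forall y, A y -> (h y)^T = h y) -> torsion_free (levi_civita h x).
Proof.
move=> oA Ax sh k i j; rewrite !levi_civitaE /christoffel; congr (_ * _).
apply: eq_bigr => l _; congr (_ * _); congr (_ - _); first exact: addrC.
by apply: (pd_eq_on _ oA Ax) => y Ay; exact: ((mx_sym _).2 (sh y Ay)).
Qed.

Lemma levi_civita_metric A h x k : open A -> A x ->
  (forall y, A y -> (h y)^T = h y) -> h x \in unitmx ->
  pdm k h x = levi_civita h x k *m h x + h x *m (levi_civita h x k)^T.
Proof.
move=> oA Ax sh uh; apply/matrixP => i j.
have sx := sh x Ax.
have -> : h x *m (levi_civita h x k)^T = (levi_civita h x k *m h x)^T.
  by rewrite trmx_mul sx.
rewrite [in RHS]mxE [X in _ = _ + X]mxE !levi_civita_koszul //.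
have S a : forall p q, pdm a h x p q = pdm a h x q p.
  by apply/mx_sym; exact: pdm_sym Ax sh.
rewrite (S k j i) (S j i k) (S i j k).
lra.
Qed.

(** Koszul's formula expresses a torsion-free metric connection through the
    derivatives of the metric. *)
Lemma levi_civita_unique A h x G : open A -> A x ->
  (forall y, A y -> (h y)^T = h y) -> h x \in unitmx -> torsion_free G ->
  (forall k, pdm k h x = G k *m h x + h x *m (G k)^T) ->
  forall k, levi_civita h x k = G k.
Proof.
move=> oA Ax sh uh tG mG k.
suff E : levi_civita h x k *m h x = G k *m h x by rewrite -(mulmxK uh (G k)) -E mulmxK.
apply/matrixP => i j; rewrite levi_civita_koszul //; last exact: sh.
have sx := sh x Ax.
have mE a p q : pdm a h x p q = (G a *m h x) p q + (G a *m h x) q p.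
  rewrite mG mxE; congr (_ + _).
  by rewrite -[h x *m _]trmxK trmx_mul trmxK sx mxE.
have tE a p q : (G a *m h x) p q = (G p *m h x) a q.
  by rewrite !mxE; apply: eq_bigr => m _; rewrite tG.
rewrite !mE (tE k j i) (tE i j k) (tE i k j).
lra.
Qed.

Lemma curvatureE h x i j : \matrix_(k, l) curvature h x i j k l =
  pdm i (levi_civita h ^~ j) x - pdm j (levi_civita h ^~ i) x
  + levi_civita h x j *m levi_civita h x i - levi_civita h x i *m levi_civita h x j.
Proof.
apply/matrixP => k l.
rewrite mxE !(addmxE, oppmxE) !pdmE /curvature -[RHS]addrA; congr (_ - _ + _).
- by congr pd; apply/funext => y; rewrite levi_civitaE.
- by congr pd; apply/funext => y; rewrite levi_civitaE.
- rewrite big_split sumrN !mxE; congr (_ - _).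
  + by apply: eq_bigr => m _; rewrite !levi_civitaE mulrC.
  + by apply: eq_bigr => m _; rewrite !levi_civitaE mulrC.
Qed.

Lemma msmooth_levi_civita A h k : open A -> (forall y, A y -> h y \in unitmx) ->
  msmooth A h -> msmooth A (levi_civita h ^~ k).
Proof.
move=> oA uh sh i j; under eq_fun do rewrite levi_civitaE /christoffel.
apply: smooth_onM => //; first exact: smooth_on_cst.
apply: smooth_on_sum => // l _.
apply: smooth_onM => //; first exact: (msmoothV oA uh sh).
apply: smooth_onD => //; last by apply: smooth_onN => //; exact: smooth_on_pd.
by apply: smooth_onD => //; exact: smooth_on_pd.
Qed.

End LeviCivita.

(** * Flat pencils in a chart *)

Section ThreeParameters.
Context {R : realType}.

Lemma quadratic_eq0 (l0 l1 l2 a b c : R) : l0 != l1 -> l0 != l2 -> l1 != l2 ->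
  a + l0 * b + l0 * l0 * c = 0 -> a + l1 * b + l1 * l1 * c = 0 ->
  a + l2 * b + l2 * l2 * c = 0 -> [/\ a = 0, b = 0 & c = 0].
Proof.
move=> n01 n02 n12 e0 e1 e2.
have f01 : b + (l0 + l1) * c = 0.
  apply: (mulfI (x := l0 - l1)); first by rewrite subr_eq0.
  by rewrite mulr0 -[RHS](subrr 0) -{1}e0 -e1; ring.
have f02 : b + (l0 + l2) * c = 0.
  apply: (mulfI (x := l0 - l2)); first by rewrite subr_eq0.
  by rewrite mulr0 -[RHS](subrr 0) -{1}e0 -e2; ring.
have c0 : c = 0.
  apply: (mulfI (x := l1 - l2)); first by rewrite subr_eq0.
  by rewrite mulr0 -[RHS](subrr 0) -{1}f01 -f02; ring.
have b0 : b = 0 by move: f01; rewrite c0 mulr0 addr0.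
by split=> //; move: e0; rewrite b0 c0 !mulr0 !addr0.
Qed.

(** The characteristic polynomial has finitely many roots. *)
Lemma three_regular_parameters n (g eta : 'M[R]_n) : eta \in unitmx ->
  exists l0 l1 l2 : R, [/\ l0 != l1, l0 != l2 & l1 != l2] /\
    [/\ g - l0 *: eta \in unitmx, g - l1 *: eta \in unitmx
      & g - l2 *: eta \in unitmx].
Proof.
move=> ue; pose p := char_poly (g *m invmx eta).
have p0 : p != 0 by rewrite monic_neq0 // char_poly_monic.
have pU l : ~~ root p l -> g - l *: eta \in unitmx.
  rewrite -eigenvalue_root_char => /negP nev.
  have -> : g - l *: eta = (g *m invmx eta - l%:M) *m eta.
    by rewrite mulmxBl mulmxKV // mul_scalar_mx.
  rewrite unitmx_mul ue andbT -row_free_unit -kermx_eq0.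
  by apply/negPn/negP => H; apply: nev.
pose s : seq R := [seq i%:R | i <- iota 0 (n + 3)].
have us : uniq s.
  by rewrite map_inj_uniq ?iota_uniq // => i j /eqP; rewrite eqr_nat => /eqP.
pose s0 := [seq l <- s | root p l]; pose s1 := [seq l <- s | ~~ root p l].
have : (size s0 < size p)%N.
  by apply: max_poly_roots => //; [exact: filter_all|exact: filter_uniq].
rewrite size_char_poly ltnS => sz0.
have cs : (size s0 + size s1 = n + 3)%N.
  rewrite /s0 /s1 !size_filter -(size_iota 0 (n + 3)) -(size_map (fun i => i%:R : R)).
  exact: count_predC.
have sz1 : (2 < size s1)%N by lia.
have us1 : uniq s1 by exact: filter_uniq.
have s1U i : (i < 3)%N -> g - s1`_i *: eta \in unitmx.
  move=> i3; apply: pU.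
  have : s1`_i \in s1 by apply: mem_nth; exact: leq_trans i3 sz1.
  by rewrite mem_filter => /andP [].
exists s1`_0, s1`_1, s1`_2; split; last by split; exact: s1U.
by split; rewrite nth_uniq //; exact: leq_trans sz1.
Qed.

End ThreeParameters.

Section Pencil.
Context {R : realType} {n : nat}.
Local Notation V := 'rV[R]_n.
Local Notation symbols := ('I_n -> 'I_n -> 'I_n -> R).

Definition connection_mx (G : symbols) (k : 'I_n) : 'M[R]_n :=
  \matrix_(i, j) G k i j.

(** A flat pencil in the coordinates of a chart, on an open set where the second
    metric is invertible. *)
Record chart_pencil (A : set V) (g eta : V -> 'M[R]_n)
    (G1 G2 : V -> symbols) : Prop := ChartPencil {
  cp_open : open A;
  cp_smooth1 : msmooth A g;
  cp_smooth2 : msmooth A eta;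
  cp_smooth_conn : forall k, msmooth A (fun y => connection_mx (G1 y) k);
  cp_sym1 : forall y, A y -> (g y)^T = g y;
  cp_sym2 : forall y, A y -> (eta y)^T = eta y;
  cp_unit : forall y, A y -> eta y \in unitmx;
  cp_conn2 : forall y, A y -> forall k i j, G2 y k i j =
    - \sum_s (eta y i s * christoffel (fun z => invmx (eta z)) y s k j);
  cp_conn : forall l y, A y -> g y - l *: eta y \in unitmx ->
    forall k i j, G1 y k i j - l * G2 y k i j =
    - \sum_s ((g y - l *: eta y) i s *
              christoffel (fun z => invmx (g z - l *: eta z)) y s k j);
  cp_flat : forall l y, A y -> g y - l *: eta y \in unitmx ->
    forall i j k m, curvature (fun z => invmx (g z - l *: eta z)) y i j k m = 0 }.

Context (A : set V) (g eta : V -> 'M[R]_n) (G1 G2 : V -> symbols).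
Hypothesis CP : chart_pencil A g eta G1 G2.

Let oA : open A := cp_open CP.

Definition conn2 (y : V) (k : 'I_n) : 'M[R]_n :=
  levi_civita (fun z => invmx (eta z)) y k.

(** The tensor [Delta_k^{ij}], by which the connection of ( , )_1 differs from
    that of ( , )_2. In this form it makes sense, and is smooth, also where
    ( , )_1 degenerates. *)
Definition delta_mxs (y : V) (k : 'I_n) : 'M[R]_n :=
  connection_mx (G1 y) k + g y *m conn2 y k.

Local Notation Gam := conn2.
Local Notation D := delta_mxs.

(** The covariant derivative along the [i]-th coordinate of the bilinear form
    [D k] on covectors, the index [k] not being differentiated. *)
Definition cov_pd (F : V -> 'I_n -> 'M[R]_n) (y : V) (i k : 'I_n) : 'M[R]_n :=
  pdm i (F ^~ k) y + (Gam y i)^T *m F y k + F y k *m Gam y i.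

Definition curvature2 (y : V) (i j : 'I_n) : 'M[R]_n :=
  pdm i (Gam ^~ j) y - pdm j (Gam ^~ i) y + Gam y j *m Gam y i - Gam y i *m Gam y j.

Lemma sym_inv2 y : A y -> (invmx (eta y))^T = invmx (eta y).
Proof. by move=> Ay; apply: invmx_sym; exact: cp_sym2 CP _ Ay. Qed.

Lemma unit_inv2 y : A y -> invmx (eta y) \in unitmx.
Proof. by move=> Ay; rewrite unitmx_inv; exact: cp_unit CP _ Ay. Qed.

Lemma smooth_inv2 : msmooth A (fun z => invmx (eta z)).
Proof. apply: (msmoothV oA (cp_unit CP)); exact: cp_smooth2 CP. Qed.

Lemma conn2_torsion_free y : A y -> torsion_free (Gam y).
Proof. by move=> Ay; apply: (levi_civita_torsion_free oA Ay); exact: sym_inv2. Qed.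

Lemma smooth_conn2 k : msmooth A (Gam ^~ k).
Proof. apply: (msmooth_levi_civita _ oA); [exact: unit_inv2|exact: smooth_inv2]. Qed.

Lemma smooth_delta k : msmooth A (D ^~ k).
Proof.
apply: msmoothD => //; first exact: cp_smooth_conn CP k.
by apply: msmoothM => //; [exact: cp_smooth1 CP|exact: smooth_conn2].
Qed.

Lemma conn_mulE (a : V -> 'M[R]_n) (G : symbols) (y : V) :
  torsion_free (levi_civita (fun z => invmx (a z)) y) ->
  (forall k i j, G k i j =
     - \sum_s (a y i s * christoffel (fun z => invmx (a z)) y s k j)) ->
  forall k, a y *m levi_civita (fun z => invmx (a z)) y k = - connection_mx G k.
Proof.
move=> tf GE k; apply/matrixP => i j; rewrite mxE oppmxE mxE GE opprK.
by apply: eq_bigr => s _; rewrite tf levi_civitaE.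
Qed.

Lemma conn2E y k : A y -> eta y *m Gam y k = - connection_mx (G2 y) k.
Proof.
by move=> Ay; apply: conn_mulE; [exact: conn2_torsion_free|exact: cp_conn2 CP _ Ay].
Qed.

Lemma pdm_eta x k : A x ->
  pdm k eta x = - ((Gam x k)^T *m eta x + eta x *m Gam x k).
Proof.
move=> Ax; have ux := cp_unit CP Ax.
have E : pdm k (fun z => invmx (eta z)) x =
    Gam x k *m invmx (eta x) + invmx (eta x) *m (Gam x k)^T.
  by apply: (levi_civita_metric _ oA Ax) => //; [exact: sym_inv2|exact: unit_inv2].
move: E; rewrite (pdmV oA k (cp_unit CP) (cp_smooth2 CP) Ax).
move=> /(congr1 (fun M => eta x *m M *m eta x)).
rewrite mulmxN mulNmx !mulmxA mulmxV // mul1mx mulmxKV // => /(congr1 -%R).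
rewrite opprK => ->.
by rewrite mulmxDr mulmxDl !mulmxA mulmxV // mul1mx mulmxKV // addrC.
Qed.

(** ** The difference of two Levi-Civita connections *)

Section PencilMember.
Context (l : R).
Let a (y : V) : 'M[R]_n := g y - l *: eta y.
Let B : set V := [set y | A y /\ a y \in unitmx].
Let Lam (y : V) := levi_civita (fun z => invmx (a z)) y.
Let S (y : V) k : 'M[R]_n := Lam y k - Gam y k.

Let smooth_a : msmooth A a.
Proof.
apply: msmoothD => //; first exact: cp_smooth1 CP.
by apply: msmoothN => //; apply: msmoothZ => //; exact: cp_smooth2 CP.
Qed.

Let oB : open B. Proof. exact: open_unitmx. Qed.

Let BA : B `<=` A. Proof. by move=> y []. Qed.

Let smoothB p q (F : V -> 'M[R]_(p, q)) : msmooth A F -> msmooth B F.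
Proof. by move=> sF i j; apply: smooth_onS (sF i j). Qed.

Let sym_a y : A y -> (a y)^T = a y.
Proof.
by move=> Ay; rewrite /a linearB linearZ /= (cp_sym1 CP Ay) (cp_sym2 CP Ay).
Qed.

Let sym_ia y : B y -> (invmx (a y))^T = invmx (a y).
Proof. by move=> [Ay _]; apply: invmx_sym; exact: sym_a. Qed.

Let tfLam y : B y -> torsion_free (Lam y).
Proof. by move=> By; apply: (levi_civita_torsion_free oB By); exact: sym_ia. Qed.

Let smooth_Lam k : msmooth B (Lam ^~ k).
Proof.
apply: (msmooth_levi_civita _ oB) => [y [_ uy]|]; first by rewrite unitmx_inv.
by apply: (msmoothV oB) => [y []//|]; exact: smoothB.
Qed.

Let smooth_S k : msmooth B (S ^~ k).
Proof.
apply: (msmoothD oB (smooth_Lam k)).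
by apply: msmoothN => //; apply: smoothB; exact: smooth_conn2.
Qed.

Let aS y k : B y -> a y *m S y k = - D y k.
Proof.
move=> By; have [Ay uy] := By.
have E : a y *m Lam y k = - connection_mx (fun k i j => G1 y k i j - l * G2 y k i j) k.
  by apply: conn_mulE; [exact: tfLam|exact: cp_conn CP _ _ Ay uy].
rewrite mulmxBr E /D /a mulmxBl -scalemxAl conn2E //.
by apply/matrixP => i j; rewrite !mxE; ring.
Qed.

(** For every member [a] of the pencil the two connections differ by [- a^{-1} Delta],
    with [Delta] independent of the member. *)
Lemma pencil_difference y k : A y -> a y \in unitmx ->
  a y *m (levi_civita (fun z => invmx (a z)) y k - Gam y k) = - D y k.
Proof. by move=> Ay uy; exact: aS. Qed.

(** Both connections are torsion-free. *)
Lemma pencil_sym x : A x -> a x \in unitmx -> forall p q r,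
  \sum_s a x p s * D x s q r = \sum_s a x q s * D x s p r.
Proof.
move=> Ax ux p q r; have Bx : B x by [].
have DE s i j : D x s i j = - \sum_m a x i m * S x s m j.
  by rewrite -[D x s]opprK -aS // oppmxE mxE.
have tS : torsion_free (S x).
  move=> k i j; rewrite !(addmxE, oppmxE) (tfLam Bx).
  by rewrite (conn2_torsion_free Ax).
under eq_bigr do rewrite DE mulrN mulr_sumr.
under [RHS]eq_bigr do rewrite DE mulrN mulr_sumr.
rewrite !sumrN; congr (- _); rewrite exchange_big; apply: eq_bigr => s _ /=.
by apply: eq_bigr => m _; rewrite tS mulrCA.
Qed.

Lemma pencil_compat x k : A x -> a x \in unitmx ->
  pdm k a x = D x k + (D x k)^T - (Gam x k)^T *m a x - a x *m Gam x k.
Proof.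
move=> Ax ux; have Bx : B x by [].
have uB y : B y -> a y \in unitmx by case.
have E : pdm k (fun z => invmx (a z)) x =
    Lam x k *m invmx (a x) + invmx (a x) *m (Lam x k)^T.
  apply: (levi_civita_metric _ oB Bx) => //; by rewrite unitmx_inv.
move: E; rewrite (pdmV oB k uB (smoothB smooth_a) Bx).
move=> /(congr1 (fun M => a x *m M *m a x)).
rewrite mulmxN mulNmx !mulmxA mulmxV // mul1mx mulmxKV // => /(congr1 -%R).
rewrite opprK => ->; rewrite mulmxDr mulmxDl !mulmxA mulmxV // mul1mx mulmxKV //.
have LE : a x *m Lam x k = a x *m Gam x k - D x k.
  by rewrite -[Lam x k](subrK (Gam x k)) mulmxDr -/(S x k) aS // addrC.
have -> : (Lam x k)^T *m a x = (a x *m Lam x k)^T by rewrite trmx_mul sym_a.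
rewrite LE trmxD trmxN trmx_mul sym_a //.
by apply/matrixP => i j; rewrite !(addmxE, oppmxE); ring.
Qed.

(** The curvature of a connection [Gam + S] is that of [Gam] plus
    [nabla_i S_j - nabla_j S_i + [S_j, S_i]]. Multiplied by [a], the terms in
    [a S = - Delta] combine by compatibility of [a]. *)
Lemma pencil_flat x i j : A x -> a x \in unitmx ->
  a x *m curvature2 x i j - (cov_pd D x i j - cov_pd D x j i)
  - (D x i)^T *m S x j + (D x j)^T *m S x i = 0.
Proof.
move=> Ax ux; have Bx : B x by [].
have dS k : mdiff (S ^~ k) x by apply: (msmooth_mdiff (smooth_S k) Bx).
have dGam k : mdiff (Gam ^~ k) x by apply: msmooth_mdiff Ax; exact: smooth_conn2.
have dD k : mdiff (D ^~ k) x by apply: msmooth_mdiff Ax; exact: smooth_delta.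
have da : mdiff a x by apply: msmooth_mdiff Ax.
have adS p q : a x *m pdm p (S ^~ q) x = - pdm p (D ^~ q) x - D x p *m S x q
    - (D x p)^T *m S x q - (Gam x p)^T *m D x q + a x *m Gam x p *m S x q.
  have : pdm p (fun y => a y *m S y q) x = - pdm p (D ^~ q) x.
    by rewrite -pdmN //; apply: (pdm_eq_on _ oB Bx) => y By; rewrite aS.
  rewrite pdmM // pencil_compat // => /(canRL (addKr _)) ->.
  rewrite !(mulmxBl, mulmxDl) -(mulmxA _ (a x)) aS // mulmxN.
  by apply/matrixP => ? ?; rewrite !(addmxE, oppmxE); ring.
have LamE k : levi_civita (fun z => invmx (a z)) x k = Gam x k + S x k.
  by rewrite addrC subrK.
have dLam p q : pdm p (Lam ^~ q) x = pdm p (Gam ^~ q) x + pdm p (S ^~ q) x.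
  rewrite -pdmD //; congr pdm; apply/funext => y.
  by rewrite addrC subrK.
have : \matrix_(k, m) curvature (fun z => invmx (a z)) x i j k m = 0.
  by apply/matrixP => k m; rewrite !mxE (cp_flat CP Ax ux).
rewrite curvatureE !dLam !LamE => /(congr1 (mulmx (a x))).
have aSx k : a x *m S x k = - D x k by exact: aS.
rewrite mulmx0 /cov_pd /curvature2 => E; rewrite -[RHS]E {E}.
(* the matrices are abstracted so that only sums in view are distributed *)
move: adS aSx; move: (a x) (S x) (D x) (Gam x) => ax s Dx Gx adS aSx.
rewrite !(mulmxBr, mulmxDr, mulmxDl) !mulmxA !adS !aSx.
by rewrite !mulNmx; apply/matrixP => ? ?; rewrite !(addmxE, oppmxE); ring.
Qed.

(** Contraction of the flatness equation with the metric eliminates its inverse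
    and leaves an identity quadratic in the parameter. *)
Lemma pencil_flat_contracted x j p r b : A x -> a x \in unitmx ->
  \sum_i a x p i * (a x *m curvature2 x i j) r b
  - \sum_i a x p i * (cov_pd D x i j - cov_pd D x j i) r b
  + \sum_t D x t p r * D x j t b - \sum_t D x t p b * D x j t r = 0.
Proof.
move=> Ax ux; have Bx : B x by [].
have tS : torsion_free (S x).
  move=> k i m; rewrite !(addmxE, oppmxE) (tfLam Bx).
  by rewrite (conn2_torsion_free Ax).
have E i : (a x *m curvature2 x i j) r b - (cov_pd D x i j - cov_pd D x j i) r b
    = \sum_t D x i t r * S x j t b - \sum_t D x j t r * S x i t b.
  have := congr1 (fun M : 'M[R]_n => M r b) (pencil_flat i j Ax ux).
  rewrite [in RHS]mxE !(addmxE, oppmxE) => E0.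
  have -> : \sum_t D x i t r * S x j t b = ((D x i)^T *m S x j) r b.
    by rewrite [RHS]mxE; apply: eq_bigr => t _; rewrite [X in _ = X * _]mxE.
  have -> : \sum_t D x j t r * S x i t b = ((D x j)^T *m S x i) r b.
    by rewrite [RHS]mxE; apply: eq_bigr => t _; rewrite [X in _ = X * _]mxE.
  by apply/eqP; rewrite -subr_eq0 -E0; apply/eqP; ring.
rewrite -sumrB; under eq_bigr do rewrite -mulrBr E mulrBr !mulr_sumr.
rewrite sumrB exchange_big /= [X in _ - X + _ - _]exchange_big /=.
have -> : \sum_t \sum_i a x p i * (D x i t r * S x j t b)
    = - \sum_t D x t p r * D x j t b.
  transitivity (\sum_t (\sum_i a x t i * D x i p r) * S x j t b).
    apply: eq_bigr => t _; rewrite -pencil_sym // mulr_suml.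
    by apply: eq_bigr => i _; rewrite mulrA.
  under eq_bigr do rewrite mulr_suml.
  rewrite exchange_big /= -sumrN; apply: eq_bigr => t _.
  have := congr1 (fun M : 'M[R]_n => M t b) (aS j Bx).
  rewrite [in RHS]mxE [in LHS]mxE => /(congr1 -%R); rewrite opprK => <-.
  rewrite mulrN opprK mulr_sumr; apply: eq_bigr => s _.
  by rewrite -(mx_sym _).2 ?sym_a //; ring.
have -> : \sum_t \sum_i a x p i * (D x j t r * S x i t b)
    = - \sum_t D x t p b * D x j t r.
  rewrite -sumrN; apply: eq_bigr => t _.
  have := congr1 (fun M : 'M[R]_n => M p b) (aS t Bx).
  rewrite [in RHS]mxE [in LHS]mxE => /(congr1 -%R); rewrite opprK => <-.
  rewrite -mulNr opprK mulr_suml; apply: eq_bigr => s _.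
  by rewrite tS; ring.
ring.
Qed.

End PencilMember.

End Pencil.

(** ** The tensor [Delta] of a flat pencil *)

Section DeltaTensor.
Context {R : realType} {n : nat}.
Local Notation V := 'rV[R]_n.
Local Notation symbols := ('I_n -> 'I_n -> 'I_n -> R).
Context (A : set V) (g eta : V -> 'M[R]_n) (G1 G2 : V -> symbols).
Hypothesis CP : chart_pencil A g eta G1 G2.

Local Notation Gam := (conn2 eta).
Local Notation D := (delta_mxs g eta G1).
Local Notation K := (curvature2 eta).
Local Notation W x i j := (cov_pd eta D x i j - cov_pd eta D x j i).

Lemma unitmx_sum_eq0 (M : 'M[R]_n) (f : 'I_n -> R) : M \in unitmx ->
  (forall p, \sum_i M p i * f i = 0) -> forall i, f i = 0.
Proof.
move=> uM Mf i; pose c : 'cV[R]_n := \col_j f j.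
have Mc : M *m c = 0.
  by apply/matrixP => p q; rewrite mxE [RHS]mxE -[RHS](Mf p);
     apply: eq_bigr => s _; rewrite mxE.
by have := mulKmx uM c; rewrite Mc mulmx0 => /matrixP /(_ i 0); rewrite !mxE.
Qed.

Lemma pencil_sum (M N : 'M[R]_n) l p (f : 'I_n -> R) :
  \sum_i (M - l *: N) p i * f i = \sum_i M p i * f i - l * \sum_i N p i * f i.
Proof.
rewrite mulr_sumr -sumrB; apply: eq_bigr => i _.
by rewrite addmxE oppmxE scalemxE; ring.
Qed.

Lemma delta_symmetric x p q r : A x ->
  \sum_s g x p s * D x s q r = \sum_s g x q s * D x s p r /\
  \sum_s eta x p s * D x s q r = \sum_s eta x q s * D x s p r.
Proof.
move=> Ax.
have [l0 [l1 [l2 [[n01 n02 n12] [u0 u1 u2]]]]] :=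
  three_regular_parameters (g x) (cp_unit CP Ax).
pose F (M : 'M[R]_n) := \sum_s M p s * D x s q r - \sum_s M q s * D x s p r.
have E l : g x - l *: eta x \in unitmx -> F (g x) + l * - F (eta x) + l * l * 0 = 0.
  move=> ul; have := pencil_sym CP Ax ul p q r => /eqP; rewrite -subr_eq0 => /eqP.
  by rewrite !pencil_sum => H; rewrite -[RHS]H /F; ring.
have [/eqP F1 /eqP F2 _] := quadratic_eq0 n01 n02 n12 (E _ u0) (E _ u1) (E _ u2).
by rewrite oppr_eq0 in F2; split; apply/eqP; rewrite -subr_eq0.
Qed.

Lemma delta_sym1 x p q r : A x ->
  \sum_s g x p s * D x s q r = \sum_s g x q s * D x s p r.
Proof. by move=> Ax; have [] := delta_symmetric p q r Ax. Qed.

Lemma delta_sym2 x p q r : A x ->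
  \sum_s eta x p s * D x s q r = \sum_s eta x q s * D x s p r.
Proof. by move=> Ax; have [] := delta_symmetric p q r Ax. Qed.

Lemma pdm_g x k : A x ->
  pdm k g x = D x k + (D x k)^T - ((Gam x k)^T *m g x + g x *m Gam x k).
Proof.
move=> Ax.
have [l [_ [_ [_ [ul _ _]]]]] := three_regular_parameters (g x) (cp_unit CP Ax).
have := pencil_compat CP k Ax ul.
have de : mdiff eta x by exact: msmooth_mdiff (cp_smooth2 CP) Ax.
have dg : mdiff g x by exact: msmooth_mdiff (cp_smooth1 CP) Ax.
have dle : mdiff (fun z => l%:M *m eta z) x by apply: mdiffM => //; exact: mdiff_cst.
under [X in pdm k X]eq_fun do rewrite -mul_scalar_mx.
rewrite pdmD //; last exact: mdiffN.
rewrite pdmN // pdmM //.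
rewrite pdm_cst mul0mx add0r (pdm_eta CP) // mul_scalar_mx.
move: (D x k) (Gam x k) => Dx Gx.
rewrite mulmxBr mulmxBl -scalemxAr -scalemxAl => /matrixP E.
apply/matrixP => i j; move: (E i j); rewrite !(addmxE, oppmxE, scalemxE); lra.
Qed.

(** The three coefficients of the quadratic identity. The leading one is the
    flatness of ( , )_2, the member of the pencil at infinity; with it the linear
    one reduces to closedness and the constant one to right-commutativity. *)
Lemma flat_coefficients x j : A x ->
  [/\ forall i, K x i j = 0, forall i, W x i j = 0 &
    forall p r b, \sum_t D x t p r * D x j t b = \sum_t D x t p b * D x j t r].
Proof.
move=> Ax; have ue := cp_unit CP Ax.
have [l0 [l1 [l2 [[n01 n02 n12] [u0 u1 u2]]]]] := three_regular_parameters (g x) ue.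
pose dd p r b := \sum_t D x t p r * D x j t b - \sum_t D x t p b * D x j t r.
pose c0 p r b := \sum_i g x p i * (g x *m K x i j) r b
  - \sum_i g x p i * W x i j r b + dd p r b.
pose c1 p r b := \sum_i eta x p i * W x i j r b
  - \sum_i eta x p i * (g x *m K x i j) r b
  - \sum_i g x p i * (eta x *m K x i j) r b.
pose c2 p r b := \sum_i eta x p i * (eta x *m K x i j) r b.
have E l p r b : g x - l *: eta x \in unitmx ->
    c0 p r b + l * c1 p r b + l * l * c2 p r b = 0.
  move=> ul; have H := pencil_flat_contracted CP j p r b Ax ul.
  rewrite -[RHS]H /c0 /c1 /c2 /dd.
  have split3 i : ((g x - l *: eta x) *m K x i j) r b =
      (g x *m K x i j) r b - l * (eta x *m K x i j) r b.
    by rewrite mulmxBl -scalemxAl addmxE oppmxE scalemxE.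
  rewrite !pencil_sum.
  under [X in _ = X - _ - _ + _ - _]eq_bigr do rewrite split3 mulrBr mulrCA.
  under [X in _ = _ - l * X - _ + _ - _]eq_bigr do rewrite split3 mulrBr mulrCA.
  by rewrite !sumrB -!mulr_sumr; ring.
have Z p r b : [/\ c0 p r b = 0, c1 p r b = 0 & c2 p r b = 0].
  by apply: quadratic_eq0 n01 n02 n12 _ _ _; exact: E.
have K0 i : K x i j = 0.
  rewrite -[K x i j](mulKmx ue); suff -> : eta x *m K x i j = 0 by rewrite mulmx0.
  apply/matrixP => r b; rewrite [RHS]mxE.
  apply: (unitmx_sum_eq0 (f := fun i => (eta x *m K x i j) r b) ue) => p.
  by have [_ _] := Z p r b.
have W0 i : W x i j = 0.
  apply/matrixP => r b; rewrite [RHS]mxE.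
  apply: (unitmx_sum_eq0 (f := fun i => (W x i j) r b) ue) => p.
  have [_ + _] := Z p r b; rewrite /c1.
  under [X in _ - X - _]eq_bigr do rewrite K0 mulmx0 mxE mulr0.
  under [X in _ - _ - X]eq_bigr do rewrite K0 mulmx0 mxE mulr0.
  by rewrite big1_eq !subr0.
split=> // p r b; have [+ _ _] := Z p r b; rewrite /c0.
under [X in X - _ + _]eq_bigr do rewrite K0 mulmx0 mxE mulr0.
under [X in _ - X + _]eq_bigr do rewrite W0 mxE mulr0.
by rewrite big1_eq subr0 add0r => /eqP; rewrite subr_eq0 => /eqP.
Qed.

Lemma conn2_flat x i j : A x -> K x i j = 0.
Proof. by move=> Ax; have [] := flat_coefficients j Ax. Qed.

Lemma cov_delta_sym x i j : A x -> cov_pd eta D x i j = cov_pd eta D x j i.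
Proof.
by move=> Ax; have [_ /(_ i) /eqP + _] := flat_coefficients j Ax; rewrite subr_eq0 => /eqP.
Qed.

Lemma delta_right_comm x j p r b : A x ->
  \sum_t D x t p r * D x j t b = \sum_t D x t p b * D x j t r.
Proof. by move=> Ax; have [_ _] := flat_coefficients j Ax; apply. Qed.

End DeltaTensor.

(** * Quasihomogeneity in a chart *)

Section Quasihomogeneous.
Context {R : realType} {n : nat}.
Local Notation V := 'rV[R]_n.
Local Notation symbols := ('I_n -> 'I_n -> 'I_n -> R).

Definition partials (v : V -> V) (x : V) : 'M[R]_n :=
  \matrix_(k < n) pdm k v x.

(** Quasihomogeneity in the coordinates of a chart, [w] being the components of
    [dtau]; [cq_dense] is the density of the points where ( , )_1 is invertible. *)
Record chart_quasihomogeneous (d : R) (A : set V) (g eta : V -> 'M[R]_n)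
    (w E e : V -> V) : Prop := ChartQuasihomogeneous {
  cq_smooth : msmooth A w;
  cq_closed : forall y, A y -> (partials w y)^T = partials w y;
  cq_E : forall y, A y -> E y = w y *m g y;
  cq_e : forall y, A y -> e y = w y *m eta y;
  cq_lie_E1 : forall y, A y -> lie_contra E g y = (d - 1) *: g y;
  cq_lie_e1 : forall y, A y -> lie_contra e g y = eta y;
  cq_lie_e2 : forall y, A y -> lie_contra e eta y = 0;
  cq_dense : forall O : set V, open O -> O `<=` A -> O !=set0 ->
    exists2 z, O z & g z \in unitmx;
  cq_regular : forall y, A y ->
    \matrix_(i, j) ((d - 1) / 2 * (i == j)%:R + nabla (fun z => invmx (eta z)) E y i j)
    \in unitmx }.

Context (d : R) (A : set V) (g eta : V -> 'M[R]_n) (G1 G2 : V -> symbols).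
Context (w E e : V -> V).
Hypothesis CP : chart_pencil A g eta G1 G2.
Hypothesis CQ : chart_quasihomogeneous d A g eta w E e.

Let oA : open A := cp_open CP.

Local Notation Gam := (conn2 eta).
Local Notation D := (delta_mxs g eta G1).

(** The covariant derivative [nabla_k v^i] of a vector field. *)
Definition cov_field (v : V -> V) (x : V) : 'M[R]_n :=
  \matrix_(k, i) nabla (fun z => invmx (eta z)) v x k i.

(** The covariant derivative [nabla_k w_i] of a covector field. *)
Definition cov_form (x : V) : 'M[R]_n :=
  \matrix_(k < n) (pdm k w x - w x *m (Gam x k)^T).

Lemma cov_fieldE v x : A x ->
  cov_field v x = partials v x + \sum_s v x 0 s *: Gam x s.
Proof.
move=> Ax; apply/matrixP => k i.
rewrite addmxE summxE [LHS]mxE /nabla [partials _ _ _ _]mxE pdmE; congr (_ + _).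
apply: eq_bigr => s _; rewrite scalemxE mulrC -levi_civitaE; congr (_ * _).
exact: conn2_torsion_free CP _ Ax _ _ _.
Qed.

Lemma row_sum_conn (v : V) x k : A x ->
  row k (\sum_s v 0 s *: Gam x s) = v *m Gam x k.
Proof.
move=> Ax; apply/rowP => i; rewrite [LHS]mxE summxE [RHS]mxE.
apply: eq_bigr => s _; rewrite scalemxE; congr (_ * _).
exact: (conn2_torsion_free CP Ax).
Qed.

(** A Lie derivative is computed by any torsion-free connection. *)
Lemma lie_contra_cov (a : V -> 'M[R]_n) (Z : 'I_n -> 'M[R]_n) v x : A x ->
  (forall k, pdm k a x = Z k - ((Gam x k)^T *m a x + a x *m Gam x k)) ->
  lie_contra v a x =
  \sum_k v x 0 k *: Z k - (cov_field v x)^T *m a x - a x *m cov_field v x.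
Proof.
move=> Ax aE.
have -> : lie_contra v a x =
    \sum_k v x 0 k *: pdm k a x - (partials v x)^T *m a x - a x *m partials v x.
  apply/matrixP => i j; rewrite !(addmxE, oppmxE) summxE [LHS]mxE.
  congr (_ - _ - _).
  - by apply: eq_bigr => k _; rewrite scalemxE pdmE.
  - rewrite [RHS]mxE; apply: eq_bigr => k _.
    by rewrite [X in _ = X * _]mxE [X in _ = X * _]mxE pdmE mulrC.
  - by rewrite [RHS]mxE; apply: eq_bigr => k _; rewrite [X in _ = _ * X]mxE pdmE.
rewrite cov_fieldE //; set P := \sum_s _ *: Gam x s.
have -> : \sum_k v x 0 k *: pdm k a x =
    \sum_k v x 0 k *: Z k - (P^T *m a x + a x *m P).
  rewrite /P mulmx_sumr linear_sum mulmx_suml -big_split -sumrB /=.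
  apply: eq_bigr => k _; rewrite aE scalerBr scalerDr; congr (_ - (_ + _)).
    by rewrite linearZ /= scalemxAl.
  by rewrite scalemxAr.
move: (partials v x) (a x) (\sum_k v x 0 k *: Z k) P => p ax z P.
by rewrite trmxD mulmxDl mulmxDr; apply/matrixP => i j;
   rewrite !(addmxE, oppmxE); ring.
Qed.

Lemma row_cov_gradient (a : V -> 'M[R]_n) (Z : 'I_n -> 'M[R]_n) v x k : A x ->
  mdiff a x -> (forall y, A y -> v y = w y *m a y) ->
  (forall k, pdm k a x = Z k - ((Gam x k)^T *m a x + a x *m Gam x k)) ->
  row k (cov_field v x) = row k (cov_form x) *m a x + w x *m Z k.
Proof.
move=> Ax da vE aE; rewrite cov_fieldE // linearD /= row_sum_conn // rowK rowK.
rewrite (pdm_eq_on _ oA Ax vE) pdmM //; last exact: msmooth_mdiff (cq_smooth CQ) Ax.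
rewrite aE vE //; move: (Z k) (Gam x k) (a x) (w x) => z G ax wx.
rewrite !(mulmxBl, mulmxBr, mulmxDr) !mulmxA.
by apply/matrixP => i j; rewrite !(addmxE, oppmxE); ring.
Qed.

Lemma cov_form_sym x : A x -> (cov_form x)^T = cov_form x.
Proof.
move=> Ax; apply/mx_sym => i j; rewrite [LHS]mxE [RHS]mxE !(addmxE, oppmxE).
congr (_ - _).
  have := (mx_sym _).2 (cq_closed CQ Ax) i j.
  by rewrite [LHS]mxE [RHS]mxE.
rewrite [LHS]mxE [RHS]mxE; apply: eq_bigr => s _; congr (_ * _).
rewrite [LHS]mxE [RHS]mxE; exact: (conn2_torsion_free CP Ax).
Qed.

(** The covariant derivative of [dtau] is symmetric as [dtau] is closed, and skew
    as its gradient [e] preserves ( , )_2. *)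
Lemma cov_form0 x : A x -> cov_form x = 0.
Proof.
move=> Ax; have ue := cp_unit CP Ax.
have aE k : pdm k eta x = 0 - ((Gam x k)^T *m eta x + eta x *m Gam x k).
  by rewrite sub0r (pdm_eta CP).
have de : mdiff eta x by exact: msmooth_mdiff (cp_smooth2 CP) Ax.
have NE : cov_field e x = cov_form x *m eta x.
  apply/row_matrixP => k; rewrite (row_cov_gradient k Ax de (cq_e CQ) aE).
  by rewrite mulmx0 addr0 row_mul.
have := cq_lie_e2 CQ Ax; rewrite (lie_contra_cov e Ax aE) NE trmx_mul.
rewrite cov_form_sym // (cp_sym2 CP Ax) big1 => [|k _]; last by rewrite scaler0.
rewrite sub0r mulmxA -opprD => /eqP; rewrite oppr_eq0 -mulr2n -scaler_nat.
rewrite scaler_eq0 pnatr_eq0 /= => /eqP /(congr1 (mulmx (invmx (eta x)))).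
rewrite mulmx0 -mulmxA mulKmx // => /(congr1 (mulmx^~ (invmx (eta x)))).
by rewrite mulmxK // mul0mx.
Qed.

Lemma pdm_w x k : A x -> pdm k w x = w x *m (Gam x k)^T.
Proof.
move=> Ax; have := congr1 (row k) (cov_form0 Ax).
by rewrite /cov_form rowK row0 => /eqP; rewrite subr_eq0 => /eqP.
Qed.

(** [grad_left x] is the operator [v |-> Delta(dtau, v)], [grad_right x] is
    [v |-> Delta(v, dtau)]. *)
Definition grad_left (x : V) : 'M[R]_n := \matrix_(k < n) (w x *m D x k).
Definition grad_right (x : V) : 'M[R]_n := \matrix_(k < n) (w x *m (D x k)^T).

Lemma cov_e x : A x -> cov_field e x = 0.
Proof.
move=> Ax.
have aE k : pdm k eta x = 0 - ((Gam x k)^T *m eta x + eta x *m Gam x k).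
  by rewrite sub0r (pdm_eta CP).
have de : mdiff eta x by exact: msmooth_mdiff (cp_smooth2 CP) Ax.
apply/row_matrixP => k; rewrite (row_cov_gradient k Ax de (cq_e CQ) aE).
by rewrite cov_form0 // !row0 mul0mx mulmx0 addr0.
Qed.

Lemma cov_E x : A x -> cov_field E x = grad_right x + grad_left x.
Proof.
move=> Ax.
have dg : mdiff g x by exact: msmooth_mdiff (cp_smooth1 CP) Ax.
have aE k := pdm_g CP k Ax.
apply/row_matrixP => k; rewrite (row_cov_gradient k Ax dg (cq_E CQ) aE).
by rewrite cov_form0 // row0 mul0mx add0r [RHS]linearD /= !rowK mulmxDr addrC.
Qed.

(** The symmetry of [Delta] moves a contraction of its form index with a gradient
    of [tau] to a contraction with [dtau]. *)
Lemma contract_delta (a : 'M[R]_n) x : A x ->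
  (forall p q r, \sum_s a p s * D x s q r = \sum_s a q s * D x s p r) ->
  \sum_k (w x *m a) 0 k *: D x k = a *m grad_left x /\
  (a *m grad_right x)^T = a *m grad_right x.
Proof.
move=> Ax sa; split.
  apply/matrixP => i j; rewrite summxE [RHS]mxE.
  under eq_bigr do rewrite scalemxE mxE mulr_suml.
  rewrite exchange_big /=.
  transitivity (\sum_m w x 0 m * \sum_k a i k * D x k m j).
    apply: eq_bigr => m _; rewrite (sa i m j) mulr_sumr.
    by apply: eq_bigr => k _; rewrite mulrA.
  under [LHS]eq_bigr do rewrite mulr_sumr.
  rewrite exchange_big /=; apply: eq_bigr => k _.
  rewrite [grad_left x _ _]mxE mxE mulr_sumr.
  by apply: eq_bigr => m _; rewrite mulrCA.
have RE i j : (a *m grad_right x) i j = \sum_m w x 0 m * \sum_k a i k * D x k j m.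
  rewrite [LHS]mxE.
  under eq_bigr do rewrite [grad_right x _ _]mxE mxE mulr_sumr.
  rewrite exchange_big /=; apply: eq_bigr => m _.
  rewrite mulr_sumr; apply: eq_bigr => k _.
  by rewrite [(D x k)^T _ _]mxE mulrCA.
by apply/mx_sym => i j; rewrite !RE; apply: eq_bigr => m _; rewrite (sa i j m).
Qed.

(** In [L_E g] the terms with [Delta(dtau, v)] cancel, and those with
    [Delta(v, dtau)] add up. *)
Lemma grad_right_regular x : A x -> g x \in unitmx ->
  grad_right x = ((1 - d) / 2)%:M.
Proof.
move=> Ax ug; have := cq_lie_E1 CQ Ax.
rewrite (lie_contra_cov E Ax (fun k => pdm_g CP k Ax)) cov_E //.
have [c1 c2] := contract_delta Ax (fun p q r => delta_sym1 CP p q r Ax).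
have -> : \sum_k E x 0 k *: (D x k + (D x k)^T) =
    g x *m grad_left x + (g x *m grad_left x)^T.
  rewrite -c1 linear_sum -big_split /=; apply: eq_bigr => k _.
  by rewrite (cq_E CQ Ax) scalerDr linearZ.
rewrite trmxD mulmxDl mulmxDr trmx_mul (cp_sym1 CP Ax).
have -> : (grad_right x)^T *m g x = g x *m grad_right x.
  by rewrite -[RHS]c2 trmx_mul (cp_sym1 CP Ax).
move=> H.
suff : g x *m grad_right x = g x *m ((1 - d) / 2)%:M.
  by move=> /(congr1 (mulmx (invmx (g x)))); rewrite !mulKmx.
rewrite mul_mx_scalar; apply/matrixP => i j.
move/matrixP: H => /(_ i j); rewrite !(addmxE, oppmxE, scalemxE); lra.
Qed.

Lemma smooth_grad_right : msmooth A grad_right.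
Proof.
move=> i j; have := msmoothM oA (cq_smooth CQ) (msmoothT (smooth_delta CP i)) 0 j.
by apply: smooth_on_eq => // y Ay; rewrite [RHS]mxE.
Qed.

(** Where [( , )_1] degenerates the identity follows by continuity. *)
Lemma grad_rightE x : A x -> grad_right x = ((1 - d) / 2)%:M.
Proof.
move=> Ax; apply/matrixP => i j; apply/eqP/negPn/negP => ne.
pose f y := grad_right y i j - ((1 - d) / 2)%:M i j.
have sf : smooth_on A f.
  by apply: smooth_onD => //; [exact: smooth_grad_right|exact: smooth_on_cst].
pose F y : 'M[R]_1 := (f y)%:M.
have sF : msmooth A F.
  move=> a b; rewrite !ord1; apply: smooth_on_eq sf => // y _.
  by rewrite mxE eqxx mulr1n.
have [||z [Az]] := cq_dense CQ (open_unitmx oA sF).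
- by move=> y [].
- by exists x; split => //; rewrite unitmxE det_scalar1 unitfE subr_eq0.
rewrite unitmxE det_scalar1 unitfE => fz ug.
by move: fz; rewrite /f grad_right_regular // subrr eqxx.
Qed.

Definition euler_op (x : V) : 'M[R]_n :=
  \matrix_(i, j) ((d - 1) / 2 * (i == j)%:R + nabla (fun z => invmx (eta z)) E x i j).

Lemma euler_opE x : euler_op x = ((d - 1) / 2)%:M + cov_field E x.
Proof. by apply/matrixP => i j; rewrite addmxE !mxE mulr_natr. Qed.

(** That [R v = Delta(dtau, v)] is what makes [dtau] the unit. *)
Lemma euler_op_left x : A x -> euler_op x = grad_left x.
Proof.
move=> Ax; rewrite euler_opE cov_E // grad_rightE // addrA -raddfD /=.
have -> : (d - 1) / 2 + (1 - d) / 2 = 0 by field.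
by rewrite raddf0 add0r.
Qed.

Lemma row_euler_op x k : A x -> row k (euler_op x) = w x *m D x k.
Proof. by move=> Ax; rewrite euler_op_left // rowK. Qed.

Lemma unit_euler_op x : A x -> euler_op x \in unitmx.
Proof. by move=> Ax; exact: (cq_regular CQ Ax). Qed.

Lemma smooth_euler_op : msmooth A euler_op.
Proof.
move=> i j; have := msmoothM oA (cq_smooth CQ) (smooth_delta CP i) 0 j.
by apply: smooth_on_eq => // y Ay; rewrite euler_op_left // [RHS]mxE.
Qed.

Lemma contract_E x : A x -> \sum_k E x 0 k *: D x k = g x *m euler_op x.
Proof.
move=> Ax; rewrite euler_op_left // (cq_E CQ Ax).
by have [] := contract_delta Ax (fun p q r => delta_sym1 CP p q r Ax).
Qed.

(** This is [L_e g = eta], the contraction of [Delta] with [e] being [eta R]. *)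
Lemma euler_op_adjoint x : A x ->
  eta x *m euler_op x + (eta x *m euler_op x)^T = eta x.
Proof.
move=> Ax; rewrite euler_op_left // -[RHS](cq_lie_e1 CQ Ax).
rewrite (lie_contra_cov e Ax (fun k => pdm_g CP k Ax)) cov_e // trmx0 mul0mx mulmx0 !subr0.
have [<- _] := contract_delta Ax (fun p q r => delta_sym2 CP p q r Ax).
rewrite -(cq_e CQ Ax) linear_sum -big_split /=; apply: eq_bigr => k _.
by rewrite [RHS]scalerDr; congr (_ + _); exact: linearZ.
Qed.

(** A three-index tensor symmetric in its first two indices and skew in its last
    two vanishes; here the first index is lowered. *)
Lemma symmetric_skew0 (M : 'M[R]_n) (Y : 'I_n -> 'M[R]_n) : M \in unitmx ->
  (forall p q r, \sum_s M p s * Y s q r = \sum_s M q s * Y s p r) ->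
  (forall i, Y i + (Y i)^T = 0) -> forall i, Y i = 0.
Proof.
move=> uM sY aY i; apply/matrixP => q r; rewrite [RHS]mxE.
apply: (unitmx_sum_eq0 (f := fun i => Y i q r) uM) => p.
pose Z a b c := \sum_s M a s * Y s b c; rewrite -/(Z p q r).
have Zs a b c : Z a b c = Z b a c by exact: sY.
have Za a b c : Z a b c = - Z a c b.
  rewrite /Z -sumrN; apply: eq_bigr => s _; rewrite -mulrN; congr (_ * _).
  have /matrixP /(_ b c) := aY s; rewrite addmxE [_^T _ _]mxE [RHS]mxE => /eqP.
  by rewrite addr_eq0 => /eqP.
have H : Z p q r = - Z p q r.
  by rewrite {1}Za Zs Za opprK Zs Za Zs.
lra.
Qed.

(** The derivative [nabla_i R_k^j] is symmetric in [i] and [k], because [R] is the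
    contraction of the closed tensor [Delta] with the parallel form [dtau]; with [k]
    raised it is skew in its last two indices, by [euler_op_adjoint]. *)
Lemma euler_op_parallel x i : A x ->
  pdm i euler_op x = Gam x i *m euler_op x - euler_op x *m Gam x i.
Proof.
move=> Ax; pose T j := pdm j euler_op x + euler_op x *m Gam x j - Gam x j *m euler_op x.
have dw : mdiff w x by exact: msmooth_mdiff (cq_smooth CQ) Ax.
have dD k : mdiff (D ^~ k) x by apply: msmooth_mdiff Ax; exact: smooth_delta CP k.
have dR : mdiff euler_op x by exact: msmooth_mdiff smooth_euler_op Ax.
have de : mdiff eta x by exact: msmooth_mdiff (cp_smooth2 CP) Ax.
have rowT j k : row k (T j) = w x *m cov_pd eta D x j k - row k (Gam x j) *m euler_op x.
  rewrite /T linearB linearD /= !row_mul row_euler_op //; congr (_ - _).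
  have -> : row k (pdm j euler_op x) = pdm j (fun y => w y *m D y k) x.
    apply/rowP => m; rewrite [LHS]mxE !pdmE; apply: (pd_eq_on _ oA Ax) => y Ay.
    by rewrite -row_euler_op // [RHS]mxE.
  rewrite pdmM // pdm_w // /cov_pd.
  move: (D x k) (Gam x j) (w x) => Dx Gx wx.
  by rewrite !mulmxDr !mulmxA; congr (_ + _); exact: addrC.
have sT j k m : T j k m = T k j m.
  have TE a b : T a b m = row b (T a) 0 m by rewrite [RHS]mxE.
  rewrite !TE !rowT (cov_delta_sym CP j k Ax) addmxE [RHS]addmxE; congr (_ + _).
  rewrite !oppmxE; congr (- _); rewrite [LHS]mxE [RHS]mxE.
  apply: eq_bigr => s _; rewrite [X in X * _]mxE [X in _ = X * _]mxE; congr (_ * _).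
  exact: (conn2_torsion_free CP Ax).
have aT j : eta x *m T j + (eta x *m T j)^T = 0.
  have : pdm j (fun y => eta y *m euler_op y + (eta y *m euler_op y)^T) x = pdm j eta x.
    by apply: (pdm_eq_on _ oA Ax) => y Ay; exact: euler_op_adjoint.
  have dP : mdiff (fun y => eta y *m euler_op y) x by exact: mdiffM.
  rewrite pdmD //; last exact: mdiffT.
  rewrite pdmT pdmM // (pdm_eta CP) //.
  have -> : pdm j euler_op x = T j - euler_op x *m Gam x j + Gam x j *m euler_op x.
    by rewrite /T; move: (pdm j euler_op x) => p; apply/matrixP => a b;
       rewrite !(addmxE, oppmxE); ring.
  have adj := euler_op_adjoint Ax; have adj' := adj.
  move: adj => /(congr1 (mulmx (Gam x j)^T)); rewrite mulmxDr.
  move: adj' => /(congr1 (mulmx^~ (Gam x j))); rewrite mulmxDl.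
  have se := cp_sym2 CP Ax.
  move: (T j) (Gam x j) (euler_op x) (eta x) se => t G r h sh E1 E2.
  rewrite !(mulmxDr, mulmxDl, mulNmx, mulmxN, trmxD, trmxN, trmx_mul) !mulmxA sh.
  move: E1 E2; rewrite !trmx_mul sh !mulmxA => /matrixP E1 /matrixP E2.
  move=> /matrixP E3; apply/matrixP => a b.
  rewrite [RHS]mxE; move: (E1 a b) (E2 a b) (E3 a b); rewrite trmxK.
  rewrite !(addmxE, oppmxE); lra.
have ue := cp_unit CP Ax.
have Y0 : forall j, eta x *m T j = 0.
  apply: (symmetric_skew0 ue _ aT) => p q r.
  under eq_bigr do rewrite mxE mulr_sumr.
  under [RHS]eq_bigr do rewrite mxE mulr_sumr.
  rewrite exchange_big /=; apply: eq_bigr => s _; apply: eq_bigr => m _.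
  by rewrite sT mulrCA.
have : T i = 0 by rewrite -(mulKmx ue (T i)) Y0 mulmx0.
rewrite /T => /eqP; rewrite subr_eq0 => /eqP <-.
by rewrite addrK.
Qed.

End Quasihomogeneous.

(** * The Frobenius structure in a chart *)

Section Components.
Context {R : realType} {n : nat}.
Local Notation V := 'rV[R]_n.

Lemma pdm_sum_scale l (f : 'I_n -> V -> R) (F : 'I_n -> V -> 'M[R]_n) x :
  (forall i, differentiable (f i) x) -> (forall i, mdiff (F i) x) ->
  pdm l (fun y => \sum_i f i y *: F i y) x =
  \sum_i (pd l (f i) x *: F i x + f i x *: pdm l (F i) x).
Proof.
move=> df dF; apply/matrixP => a b; rewrite pdmE summxE.
under eq_fun do rewrite summxE.
rewrite pd_sum => [|i _]; last first.
  by under eq_fun do rewrite scalemxE; apply: differentiableM => //; exact: dF.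
apply: eq_bigr => i _; under eq_fun do rewrite scalemxE.
by rewrite pdM //; [rewrite addmxE !scalemxE pdmE|exact: dF].
Qed.

Lemma tmulE (c : 'I_n -> 'I_n -> 'I_n -> R) (M : 'I_n -> 'M[R]_n) (u v : V) :
  (forall i j k, c i j k = M i j k) -> tmul c u v = v *m \sum_i u 0 i *: M i.
Proof.
move=> cM; apply/rowP => k; rewrite [LHS]mxE mulmx_sumr summxE.
apply: eq_bigr => i _; rewrite [RHS]mxE; apply: eq_bigr => j _.
by rewrite cM scalemxE; ring.
Qed.

Lemma formE (h : 'M[R]_n) (u v : V) : Defs.form h u v = (u *m h *m v^T) 0 0.
Proof.
rewrite /Defs.form exchange_big [RHS]mxE; apply: eq_bigr => j _ /=.
rewrite [X in _ = _ * X]mxE [X in _ = X * _]mxE mulr_suml; apply: eq_bigr => i _; ring.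
Qed.

Lemma bracketE (v u : V -> V) x :
  bracket v u x = \sum_l v x 0 l *: pdm l u x - u x *m partials v x.
Proof.
apply/rowP => k; rewrite [LHS]mxE addmxE oppmxE summxE [X in _ = _ - X]mxE -sumrB.
by apply: eq_bigr => i _; rewrite scalemxE pdmE [partials _ _ _ _]mxE pdmE.
Qed.

End Components.

Section ChartFrobenius.
Context {R : realType} {n : nat}.
Local Notation V := 'rV[R]_n.
Local Notation symbols := ('I_n -> 'I_n -> 'I_n -> R).
Context (d : R) (A : set V) (g eta : V -> 'M[R]_n) (G1 G2 : V -> symbols).
Context (w E e : V -> V).
Hypothesis CP : chart_pencil A g eta G1 G2.
Hypothesis CQ : chart_quasihomogeneous d A g eta w E e.

Let oA : open A := cp_open CP.

Local Notation Gam := (conn2 eta).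
Local Notation D := (delta_mxs g eta G1).
Local Notation Rm := (euler_op d eta E).
Local Notation h := (fun y => invmx (eta y)).

(** The matrices of the product of covectors and, with an index lowered, of the
    multiplication operators on vectors. *)
Fact product_key : unit. Proof. exact: tt. Qed.

Definition dual_mx : V -> 'I_n -> 'M[R]_n :=
  locked_with product_key (fun x k => D x k *m invmx (Rm x)).

Definition mult_mx : V -> 'I_n -> 'M[R]_n :=
  locked_with product_key (fun x i => invmx (eta x) *m dual_mx x i).

Local Notation C := dual_mx.
Local Notation M := mult_mx.

Lemma dual_mxE x k : C x k = D x k *m invmx (Rm x).
Proof. by rewrite /dual_mx unlock. Qed.

Lemma mult_mxE x i : M x i = invmx (eta x) *m C x i.
Proof. by rewrite /mult_mx unlock. Qed.

Lemma dual_mxK x k : A x -> C x k *m Rm x = D x k.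
Proof. by move=> Ax; rewrite dual_mxE mulmxKV //; exact: unit_euler_op CQ _ Ax. Qed.

Lemma smooth_dual k : msmooth A (C ^~ k).
Proof.
apply: (@msmooth_eq _ _ _ oA _ _ (fun y => D y k *m invmx (Rm y))) => [y _|].
  by rewrite dual_mxE.
apply: msmoothM => //; first exact: smooth_delta CP k.
by apply: msmoothV => //; [move=> y Ay; exact: unit_euler_op CQ _ Ay|exact: smooth_euler_op CP CQ].
Qed.

Lemma smooth_mult i : msmooth A (M ^~ i).
Proof.
apply: (@msmooth_eq _ _ _ oA _ _ (fun y => h y *m C y i)) => [y _|].
  by rewrite mult_mxE.
by apply: msmoothM => //; [exact: smooth_inv2 CP|exact: smooth_dual].
Qed.

(** Commutativity: contract the right-commutativity of [Delta] with [dtau]. *)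
Lemma dual_sym x k : A x -> (C x k)^T = C x k.
Proof.
move=> Ax; have uR := unit_euler_op CQ Ax.
have RE p q : Rm x p q = \sum_s w x 0 s * D x p s q.
  have := congr1 (fun r : V => r 0 q) (row_euler_op CP CQ p Ax).
  by rewrite [LHS]mxE [RHS]mxE.
have S a b : ((Rm x)^T *m D x k) a b =
    \sum_s w x 0 s * \sum_t D x t s a * D x k t b.
  rewrite [LHS]mxE; under eq_bigr do rewrite [X in X * _]mxE RE mulr_suml.
  rewrite exchange_big /=; apply: eq_bigr => s _; rewrite mulr_sumr.
  by apply: eq_bigr => t _; rewrite mulrA.
have : (D x k)^T *m Rm x = (Rm x)^T *m D x k.
  rewrite -[LHS]trmxK trmx_mul trmxK; apply/matrixP => a b; rewrite [LHS]mxE !S.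
  by apply: eq_bigr => s _; rewrite (delta_right_comm CP).
move=> H; rewrite dual_mxE trmx_mul trmx_inv.
have uRT : (Rm x)^T \in unitmx by rewrite unitmx_tr.
rewrite -[LHS](mulmxK uR) -[_ *m _ *m Rm x]mulmxA H mulKmx //.
Qed.

Lemma dual_sym_entry x k i j : A x -> C x k i j = C x k j i.
Proof. by move=> Ax; exact: (mx_sym _).2 (dual_sym k Ax) i j. Qed.

Lemma dual_sym2 x p q r : A x ->
  \sum_s eta x p s * C x s q r = \sum_s eta x q s * C x s p r.
Proof.
move=> Ax.
have CE a b : \sum_s eta x a s * C x s b r =
    \sum_m (\sum_s eta x a s * D x s b m) * invmx (Rm x) m r.
  under eq_bigr do rewrite dual_mxE [(D x _ *m _) _ _]mxE mulr_sumr.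
  rewrite exchange_big /=; apply: eq_bigr => m _; rewrite mulr_suml.
  by apply: eq_bigr => s _; rewrite mulrA.
by rewrite !CE; apply: eq_bigr => m _; rewrite (delta_sym2 CP).
Qed.

Lemma dual_right_comm x j p r b : A x ->
  \sum_t C x t p r * C x j t b = \sum_t C x t p b * C x j t r.
Proof.
move=> Ax; pose Ri := invmx (Rm x).
have CE a c : \sum_t C x t p a * C x j t c =
    \sum_m \sum_l Ri m a * Ri l c * \sum_t D x t p m * D x j t l.
  under eq_bigr do rewrite (dual_mxE x) [(D x _ *m _) p _]mxE mulr_suml.
  rewrite exchange_big /=; apply: eq_bigr => m _.
  under eq_bigr do rewrite dual_mxE [(D x _ *m _) _ _]mxE mulr_sumr.
  rewrite exchange_big /=; apply: eq_bigr => l _.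
  rewrite mulr_sumr; apply: eq_bigr => t _; rewrite /Ri; ring.
rewrite !CE exchange_big /=; apply: eq_bigr => l _; apply: eq_bigr => m _.
by rewrite (delta_right_comm CP) // (mulrC (Ri m r)).
Qed.

Lemma dual_unit x k : A x -> w x *m C x k = delta_mx 0 k.
Proof.
move=> Ax; rewrite dual_mxE mulmxA -(row_euler_op CP CQ) // -row_mul mulmxV.
  by rewrite row1.
exact: unit_euler_op CQ _ Ax.
Qed.

(** The contraction of [Delta] with [E] is [g R]; this yields the intersection
    form. *)
Lemma dual_E x : A x -> \sum_k E x 0 k *: C x k = g x.
Proof.
move=> Ax.
have -> : \sum_k E x 0 k *: C x k = (\sum_k E x 0 k *: D x k) *m invmx (Rm x).
  by rewrite mulmx_suml; apply: eq_bigr => k _; rewrite dual_mxE scalemxAl.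
by rewrite (contract_E CP CQ) // mulmxK //; exact: unit_euler_op CQ _ Ax.
Qed.

(** The operator [R] being parallel, the product inherits the closedness of
    [Delta]. *)
Lemma cov_dual_sym x i k : A x -> cov_pd eta C x i k = cov_pd eta C x k i.
Proof.
move=> Ax.
suff E0 a b : cov_pd eta C x a b = cov_pd eta D x a b *m invmx (Rm x).
  by rewrite !E0 (cov_delta_sym CP).
have uR := unit_euler_op CQ Ax.
have dC : mdiff (C ^~ b) x by apply: msmooth_mdiff Ax; exact: smooth_dual.
have dR : mdiff Rm x by apply: msmooth_mdiff Ax; exact: smooth_euler_op CP CQ.
have H : pdm a (D ^~ b) x = pdm a (C ^~ b) x *m Rm x + C x b *m pdm a Rm x.
  rewrite -pdmM //; apply: (pdm_eq_on _ oA Ax) => y Ay.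
  by rewrite dual_mxK.
rewrite /cov_pd H (euler_op_parallel CP CQ) // -(dual_mxK b Ax).
rewrite -[LHS](mulmxK uR); congr (_ *m _).
move: (C x b) (Rm x) (Gam x a) (pdm a (C ^~ b) x) => c r G p.
rewrite !(mulmxDl, mulmxBr) !mulmxA.
by apply/matrixP => ? ?; rewrite !(addmxE, oppmxE); ring.
Qed.

(** ** Algebra at a point *)

(** With its two lower indices raised, [c_{ij}^k] is symmetric in them by
    [dual_sym2]. *)
Lemma mult_comm x i j k : A x -> M x i j k = M x j i k.
Proof.
move=> Ax; pose T a b c := \sum_s eta x a s * C x s b c.
have TC a b c : C x a b c = \sum_q invmx (eta x) a q * T q b c.
  have := congr1 (fun m : 'cV[R]_n => m a 0)
    (mulKmx (cp_unit CP Ax) (\col_s C x s b c)).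
  rewrite [X in _ = X -> _]mxE => <-; rewrite [LHS]mxE.
  apply: eq_bigr => q _; congr (_ * _); rewrite [LHS]mxE.
  by apply: eq_bigr => s _; rewrite [X in _ * X]mxE.
have ME a b c : M x a b c =
    \sum_p \sum_q invmx (eta x) b p * invmx (eta x) a q * T q p c.
  rewrite mult_mxE [LHS]mxE; apply: eq_bigr => p _; rewrite TC mulr_sumr.
  by apply: eq_bigr => q _; rewrite mulrA.
rewrite !ME exchange_big /=; apply: eq_bigr => p _; apply: eq_bigr => q _.
rewrite (mulrC (invmx _ _ _)); congr (_ * _); exact: dual_sym2.
Qed.

(** In a commutative algebra associativity says that multiplication operators
    commute; for covectors this is right-commutativity. *)
Lemma mult_commute x i l : A x -> M x i *m M x l = M x l *m M x i.
Proof.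
move=> Ax; rewrite !mult_mxE -!mulmxA; congr (_ *m _).
have Q p q a b : (C x p *m (invmx (eta x) *m C x q)) a b =
    \sum_m invmx (eta x) q m * \sum_t C x t m b * C x p t a.
  rewrite [LHS]mxE.
  under eq_bigr => s _.
    rewrite -mult_mxE mult_comm // mult_mxE [(invmx _ *m _) _ _]mxE mulr_sumr.
    over.
  rewrite exchange_big /=; apply: eq_bigr => m _; rewrite mulr_sumr.
  by apply: eq_bigr => t _; rewrite (dual_sym_entry p a t) //; ring.
have S : (C x i *m (invmx (eta x) *m C x l))^T = C x i *m (invmx (eta x) *m C x l).
  by apply/mx_sym => a b; rewrite !Q; apply: eq_bigr => m _; rewrite dual_right_comm.
by rewrite -S !trmx_mul !dual_sym // (sym_inv2 CP Ax) mulmxA.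
Qed.

Lemma mult_unit x : A x -> \sum_i e x 0 i *: M x i = 1%:M.
Proof.
move=> Ax.
have -> : \sum_i e x 0 i *: M x i = invmx (eta x) *m \sum_i e x 0 i *: C x i.
  by rewrite mulmx_sumr; apply: eq_bigr => i _; rewrite mult_mxE scalemxAr.
suff -> : \sum_i e x 0 i *: C x i = eta x by rewrite mulVmx //; exact: cp_unit CP _ Ax.
apply/matrixP => p r; rewrite summxE.
under eq_bigr do rewrite scalemxE (cq_e CQ Ax) mxE mulr_suml.
rewrite exchange_big /=.
transitivity (\sum_m w x 0 m * \sum_i eta x p i * C x i m r).
  apply: eq_bigr => m _; rewrite (dual_sym2 p m r Ax) mulr_sumr.
  by apply: eq_bigr => i _; rewrite mulrA.
under eq_bigr do rewrite mulr_sumr.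
rewrite exchange_big /= (bigD1 r) //= [X in _ + X]big1 => [|i ir].
  have := congr1 (fun v : V => v 0 r) (dual_unit r Ax); rewrite [LHS]mxE [RHS]mxE !eqxx /= => H.
  rewrite addr0 -[RHS]mulr1 -[1]H mulr_sumr; apply: eq_bigr => m _; exact: mulrCA.
have := congr1 (fun v : V => v 0 r) (dual_unit i Ax).
rewrite [LHS]mxE [RHS]mxE eqxx eq_sym (negbTE ir) /= => H.
rewrite -[RHS](mulr0 (eta x p i)) -[0 in RHS]H mulr_sumr; apply: eq_bigr => m _; exact: mulrCA.
Qed.

(** The totally symmetric tensor [<u v, w>]. *)
Definition lower_mx (x : V) (i : 'I_n) : 'M[R]_n := M x i *m invmx (eta x).

Lemma lower_sym23 x i j k : A x -> lower_mx x i j k = lower_mx x i k j.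
Proof.
move=> Ax; apply: (mx_sym _).2.
by rewrite /lower_mx mult_mxE !trmx_mul dual_sym // (sym_inv2 CP Ax) mulmxA.
Qed.

Lemma lower_sym12 x i j k : A x -> lower_mx x i j k = lower_mx x j i k.
Proof.
move=> Ax; rewrite [LHS]mxE [RHS]mxE.
by apply: eq_bigr => s _; rewrite (mult_comm i j).
Qed.

Lemma chart_frobenius_algebra x : A x ->
  frobenius_algebra (fun i j k => M x i j k) (e x) (invmx (eta x)).
Proof.
move=> Ax; have ue := cp_unit CP Ax.
have tE u v : tmul (fun i j k => M x i j k) u v = v *m \sum_i u 0 i *: M x i.
  exact: tmulE.
have comm u v : tmul (fun i j k => M x i j k) u v = tmul (fun i j k => M x i j k) v u.
  apply/rowP => k; rewrite [LHS]mxE [RHS]mxE exchange_big /=.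
  by apply: eq_bigr => i _; apply: eq_bigr => j _; rewrite (mult_comm i j) //; ring.
have inv u v z : Defs.form (invmx (eta x)) (tmul (fun i j k => M x i j k) u v) z =
    \sum_i \sum_j \sum_k lower_mx x i j k * u 0 i * v 0 j * z 0 k.
  rewrite formE tE mulmx_sumr !mulmx_suml summxE; apply: eq_bigr => i _.
  rewrite -scalemxAr -!scalemxAl scalemxE.
  rewrite -[v *m M x i *m _]mulmxA -/(lower_mx x i) -mulmxA [(v *m _) 0 0]mxE mulr_sumr.
  apply: eq_bigr => j _; rewrite [(lower_mx x i *m _) j 0]mxE !mulr_sumr.
  by apply: eq_bigr => k _; rewrite [_^T _ _]mxE; ring.
have sym u v : Defs.form (invmx (eta x)) u v = Defs.form (invmx (eta x)) v u.
  rewrite !formE.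
  have -> : v *m invmx (eta x) *m u^T = (u *m invmx (eta x) *m v^T)^T.
    by rewrite !trmx_mul trmxK (sym_inv2 CP Ax) mulmxA.
  by rewrite [RHS]mxE.
split.
- exact: comm.
- move=> u v z; rewrite (comm _ z) (comm v z) !tE -!mulmxA; congr (_ *m _).
  rewrite mulmx_suml mulmx_sumr; apply: eq_bigr => i _.
  rewrite mulmx_suml mulmx_sumr; apply: eq_bigr => j _.
  by rewrite -!scalemxAr -!scalemxAl mult_commute // scalerA mulrC -scalerA.
- by move=> u; rewrite tE mult_unit // mulmx1.
- exact: sym.
- move=> u H; rewrite -(mulmxK (unit_inv2 CP Ax) u).
  suff -> : u *m invmx (eta x) = 0 by rewrite mul0mx.
  apply/rowP => k; have := H (delta_mx 0 k).
  by rewrite formE trmx_delta -colE => H0; rewrite [RHS]mxE -H0 [RHS]mxE.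
- move=> u v z; rewrite inv sym inv.
  under [RHS]eq_bigr do rewrite exchange_big.
  rewrite [RHS]exchange_big /=.
  apply: eq_bigr => i _; apply: eq_bigr => j _; apply: eq_bigr => k _.
  by rewrite (lower_sym23 j k i) // (lower_sym12 j i k) //; ring.
Qed.

Lemma dual_productE x u v k : A x ->
  (tmul (fun i j k => M x i j k) (u *m eta x) (v *m eta x) *m invmx (eta x)) 0 k =
  (u *m C x k *m v^T) 0 0.
Proof.
move=> Ax; have ue := cp_unit CP Ax.
rewrite (tmulE (M := M x)) // mulmx_sumr mulmx_suml summxE.
transitivity (\sum_i \sum_p \sum_b u 0 p * eta x p i * v 0 b * (C x i *m invmx (eta x)) b k).
  apply: eq_bigr => i _.
  rewrite -scalemxAr -scalemxAl scalemxE mult_mxE !mulmxA mulmxK // -mulmxA.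
  rewrite [X in X * _]mxE mulr_suml; apply: eq_bigr => p _.
  by rewrite mxE mulr_sumr; apply: eq_bigr => b _; rewrite mulrA.
rewrite exchange_big [RHS]mxE /= [RHS](eq_bigr (fun b => \sum_p u 0 p * C x k p b * v 0 b)).
  rewrite [RHS]exchange_big /=; apply: eq_bigr => p _.
  rewrite exchange_big /=; apply: eq_bigr => b _.
  transitivity (u 0 p * v 0 b * \sum_i eta x p i * (C x i *m invmx (eta x)) b k).
    by rewrite mulr_sumr; apply: eq_bigr => i _; ring.
  have -> : \sum_i eta x p i * (C x i *m invmx (eta x)) b k = C x k p b; last by ring.
  transitivity (\sum_r (\sum_i eta x p i * C x i b r) * invmx (eta x) r k).
    under eq_bigr do rewrite mxE mulr_sumr.
    rewrite exchange_big /=; apply: eq_bigr => r _; rewrite mulr_suml.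
    by apply: eq_bigr => i _; rewrite mulrA.
  have -> : C x k p b = \sum_r invmx (eta x) k r * \sum_i eta x r i * C x i p b.
    have := congr1 (fun m : 'cV[R]_n => m k 0) (mulKmx ue (\col_s C x s p b)).
    rewrite [X in _ = X -> _]mxE => <-; rewrite [LHS]mxE.
    apply: eq_bigr => q _; congr (_ * _); rewrite [LHS]mxE.
    by apply: eq_bigr => s _; rewrite [X in _ * X]mxE.
  apply: eq_bigr => r _; rewrite mulrC (mx_sym _).2 ?(sym_inv2 CP) //; congr (_ * _).
  rewrite (dual_sym2 p b r Ax).
  under eq_bigr do rewrite (dual_sym_entry _ p r Ax).
  rewrite (dual_sym2 b r p Ax).
  by apply: eq_bigr => i _; rewrite (dual_sym_entry i b p Ax).
by move=> b _; rewrite [X in X * _]mxE mulr_suml; apply: eq_bigr => p _; rewrite [v^T _ _]mxE.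
Qed.

Lemma intersectionE x u v : A x ->
  \sum_k E x 0 k * (u *m C x k *m v^T) 0 0 = Defs.form (g x) u v.
Proof.
move=> Ax; rewrite formE -(dual_E Ax) mulmx_sumr mulmx_suml summxE.
by apply: eq_bigr => k _; rewrite -scalemxAr -scalemxAl scalemxE.
Qed.

(** ** Differential identities *)

Lemma pdm_inv2 x k : A x ->
  pdm k h x = Gam x k *m h x + h x *m (Gam x k)^T.
Proof.
by move=> Ax; apply: (levi_civita_metric _ oA Ax);
  [exact: sym_inv2 CP|exact: unit_inv2 CP _ Ax].
Qed.

Lemma chart_flat x i j k l : A x -> curvature h x i j k l = 0.
Proof.
move=> Ax; have := congr1 (fun m : 'M[R]_n => m k l) (conn2_flat CP i j Ax).
by rewrite /curvature2 -curvatureE !mxE.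
Qed.

Lemma chart_unit_parallel x i j : A x -> nabla h e x i j = 0.
Proof.
move=> Ax; have := congr1 (fun m : 'M[R]_n => m i j) (cov_e CP CQ Ax).
by rewrite !mxE.
Qed.

(** The metric is parallel, so that lowering indices commutes with [nabla]. *)
Lemma cov_lowerE x l i : A x ->
  \matrix_(j, k) nabla_cov3 h (fun y i j k => lower_mx y i j k) x l i j k =
  h x *m (cov_pd eta C x l i - \sum_m Gam x l i m *: C x m) *m h x.
Proof.
move=> Ax.
have dC k : mdiff (C ^~ k) x by apply: msmooth_mdiff Ax; exact: smooth_dual.
have dh : mdiff h x by apply: msmooth_mdiff Ax; exact: smooth_inv2 CP.
have lE y m : lower_mx y m = h y *m C y m *m h y by rewrite /lower_mx mult_mxE.
have -> : \matrix_(j, k) nabla_cov3 h (fun y i j k => lower_mx y i j k) x l i j k =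
    pdm l (lower_mx ^~ i) x - \sum_m Gam x l i m *: lower_mx x m
    - Gam x l *m lower_mx x i - lower_mx x i *m (Gam x l)^T.
  apply/matrixP => j k; rewrite !(addmxE, oppmxE) summxE [LHS]mxE /nabla_cov3 -pdmE.
  congr (_ - _ - _ - _).
  - by apply: eq_bigr => m _; rewrite scalemxE levi_civitaE.
  - by rewrite [RHS]mxE; apply: eq_bigr => m _; rewrite levi_civitaE.
  - rewrite [RHS]mxE; apply: eq_bigr => m _.
    by rewrite [X in _ = _ * X]mxE levi_civitaE mulrC.
have -> : pdm l (lower_mx ^~ i) x = pdm l (fun y => h y *m C y i *m h y) x.
  by congr pdm; apply/funext => y; rewrite lE.
rewrite pdmM //; last by apply: mdiffM.
rewrite pdmM // pdm_inv2 // lE mulmxBr mulmxBl mulmx_sumr mulmx_suml /cov_pd.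
have -> : \sum_m Gam x l i m *: lower_mx x m =
    \sum_m h x *m (Gam x l i m *: C x m) *m h x.
  by apply: eq_bigr => m _; rewrite lE -scalemxAr -scalemxAl.
move: (\sum_m h x *m (Gam x l i m *: C x m) *m h x) => S.
move: (C x i) (pdm l (C ^~ i) x) (Gam x l) (invmx (eta x)) => c p G hx.
rewrite !(mulmxDl, mulmxDr) !mulmxA.
by apply/matrixP => a b; rewrite !(addmxE, oppmxE); ring.
Qed.

Lemma chart_FM2 x l i j k : A x ->
  let N := nabla_cov3 h (fun y i j k => lower_mx y i j k) x in
  [/\ N l i j k = N i l j k, N l i j k = N l j i k & N l i j k = N l i k j].
Proof.
move=> Ax N; split.
- have E0 a b : N a b j k = (h x *m (cov_pd eta C x a b - \sum_m Gam x a b m *: C x m) *m h x) j k.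
    by rewrite -cov_lowerE // [RHS]mxE.
  rewrite !E0 (cov_dual_sym l i Ax); congr ((_ *m (_ - _) *m _) _ _).
  by apply: eq_bigr => m _; rewrite (conn2_torsion_free CP Ax).
- rewrite /N /nabla_cov3; congr (_ - _).
    rewrite -!addrA; congr (_ + _).
      by apply: (pd_eq_on _ oA Ax) => y Ay; rewrite lower_sym12.
    rewrite addrC; congr (- _ - _).
      by apply: eq_bigr => m _; rewrite lower_sym12.
    by apply: eq_bigr => m _; rewrite lower_sym12.
  by apply: eq_bigr => m _; rewrite lower_sym12.
- rewrite /N /nabla_cov3 -!addrA; congr (_ + (_ + _)).
  + by apply: (pd_eq_on _ oA Ax) => y Ay; rewrite lower_sym23.
  + by congr (- _); apply: eq_bigr => m _; rewrite lower_sym23.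
  + rewrite addrC; congr (- _ - _).
      by apply: eq_bigr => m _; rewrite lower_sym23.
    by apply: eq_bigr => m _; rewrite lower_sym23.
Qed.

Lemma chart_euler_affine x i j k : A x -> nabla2 h E x i j k = 0.
Proof.
move=> Ax; pose c : R := (d - 1) / 2.
have NE y a b : nabla h E y a b = Rm y a b - c%:M a b.
  by rewrite euler_opE addmxE addrC addKr mxE.
have dR a b : differentiable (fun y => Rm y a b) x.
  by apply: smooth_on_diff Ax; exact: (smooth_euler_op CP CQ a b).
rewrite /nabla2.
have -> : pd i (fun y => nabla h E y j k) x = pdm i Rm x j k.
  under eq_fun do rewrite NE.
  rewrite pdD // pd_cst.
  by rewrite addr0 pdmE.
have -> : \sum_m christoffel h x i j m * nabla h E x m k =
    (Gam x i *m (Rm x - c%:M)) j k.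
  rewrite [RHS]mxE; apply: eq_bigr => m _.
  by rewrite NE -levi_civitaE addmxE oppmxE.
have -> : \sum_m christoffel h x i m k * nabla h E x j m =
    ((Rm x - c%:M) *m Gam x i) j k.
  rewrite [RHS]mxE; apply: eq_bigr => m _.
  by rewrite NE -levi_civitaE addmxE oppmxE mulrC.
rewrite (euler_op_parallel CP CQ) // mulmxBr mulmxBl scalar_mxC.
by rewrite !(addmxE, oppmxE); ring.
Qed.

End ChartFrobenius.

(** ** The Euler vector field *)

Section EulerField.
Context {R : realType} {n : nat}.
Local Notation V := 'rV[R]_n.
Local Notation symbols := ('I_n -> 'I_n -> 'I_n -> R).
Context (d : R) (A : set V) (g eta : V -> 'M[R]_n) (G1 G2 : V -> symbols).
Context (w E e : V -> V).
Hypothesis CP : chart_pencil A g eta G1 G2.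
Hypothesis CQ : chart_quasihomogeneous d A g eta w E e.

Let oA : open A := cp_open CP.

Local Notation Gam := (conn2 eta).
Local Notation D := (delta_mxs g eta G1).
Local Notation Rm := (euler_op d eta E).
Local Notation h := (fun y => invmx (eta y)).
Local Notation C := (dual_mx d g eta G1 E).
Local Notation M := (mult_mx d g eta G1 E).
Local Notation dE := (partials E).

Let P (x : V) := \sum_l E x 0 l *: Gam x l.

Lemma smooth_E : msmooth A E.
Proof.
have H := msmoothM oA (cq_smooth CQ) (cp_smooth1 CP).
by apply: (msmooth_eq oA _ H) => y Ay; rewrite (cq_E CQ).
Qed.

Lemma euler_op_conn x : A x -> Rm x = ((d - 1) / 2)%:M + (dE x + P x).
Proof. by move=> Ax; rewrite euler_opE (cov_fieldE CP). Qed.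

(** [R] plus its adjoint being the identity, [E] is a homothety of the metric. *)
Lemma lie_inv2 x : A x ->
  \sum_l E x 0 l *: pdm l h x = (2 - d) *: h x - dE x *m h x - h x *m (dE x)^T.
Proof.
move=> Ax; have ue := cp_unit CP Ax.
have -> : \sum_l E x 0 l *: pdm l h x = P x *m h x + h x *m (P x)^T.
  rewrite /P mulmx_suml linear_sum mulmx_sumr -big_split /=.
  apply: eq_bigr => l _; rewrite (pdm_inv2 CP) // scalerDr scalemxAl; congr (_ + _).
  by rewrite scalemxAr; congr (_ *m _); rewrite linearZ.
have := euler_op_adjoint CP CQ Ax.
move=> /(congr1 (fun m => h x *m m *m h x)).
rewrite trmx_mul (cp_sym2 CP Ax) mulmxDr mulmxDl mulKmx // !mulmxA mulmxK // mulVmx // mul1mx.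
rewrite euler_op_conn //; move: (dE x) (P x) (invmx (eta x)) => ed p hx.
rewrite !(trmxD, mulmxDl, mulmxDr) tr_scalar_mx mul_scalar_mx mul_mx_scalar.
move=> /matrixP H; apply/matrixP => i j; move: (H i j).
rewrite !(addmxE, oppmxE, scalemxE); lra.
Qed.

(** The product has degree one: [nabla_E] is traded for [nabla_i] by closedness
    and the contraction of the product with [E] is [( , )_1]. *)
Lemma lie_dual x a : A x ->
  \sum_l E x 0 l *: pdm l (C ^~ a) x =
  (d - 1) *: C x a + C x a *m dE x + (dE x)^T *m C x a - \sum_l dE x a l *: C x l.
Proof.
move=> Ax.
have dC k : mdiff (C ^~ k) x by apply: msmooth_mdiff Ax; exact: smooth_dual CP CQ k.
have dEd l : differentiable (fun y => E y 0 l) x.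
  by apply: smooth_on_diff Ax; exact: (smooth_E 0 l).
have cov : \sum_l E x 0 l *: cov_pd eta C x l a = \sum_l E x 0 l *: cov_pd eta C x a l.
  by apply: eq_bigr => l _; rewrite (cov_dual_sym CP CQ).
have L : \sum_l E x 0 l *: cov_pd eta C x l a =
    \sum_l E x 0 l *: pdm l (C ^~ a) x + (P x)^T *m C x a + C x a *m P x.
  rewrite /P linear_sum mulmx_suml mulmx_sumr -!big_split /=.
  apply: eq_bigr => l _; rewrite /cov_pd !scalerDr; congr (_ + _ + _).
    by rewrite scalemxAl; congr (_ *m _); rewrite linearZ.
  by rewrite scalemxAr.
have Rr : \sum_l E x 0 l *: cov_pd eta C x a l =
    pdm a g x - \sum_l dE x a l *: C x l + (Gam x a)^T *m g x + g x *m Gam x a.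
  have -> : pdm a g x = \sum_l (dE x a l *: C x l + E x 0 l *: pdm a (C ^~ l) x).
    have gE y : A y -> g y = \sum_l E y 0 l *: C y l by move=> Ay; rewrite (dual_E CP CQ).
    rewrite (pdm_eq_on _ oA Ax gE).
    rewrite (@pdm_sum_scale _ _ a (fun l y => E y 0 l) (fun l y => C y l)) //.
    by apply: eq_bigr => l _; rewrite [dE x _ _]mxE pdmE.
  rewrite big_split /= (addrC (\sum_l dE x a l *: C x l)) addrK -{1 2}(dual_E CP CQ Ax).
  rewrite mulmx_sumr mulmx_suml -!big_split /=.
  apply: eq_bigr => l _; rewrite /cov_pd !scalerDr; congr (_ + _ + _).
    by rewrite scalemxAr.
  by rewrite scalemxAl.
move: cov; rewrite L Rr (pdm_g CP) // -(dual_mxK G1 CQ a Ax) trmx_mul (dual_sym CP CQ) //.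
rewrite euler_op_conn // mulmxDr trmxD trmxD mulmxDl tr_scalar_mx.
rewrite mul_scalar_mx mul_mx_scalar.
move: (\sum_l dE x a l *: C x l) (\sum_l E x 0 l *: pdm l (C ^~ a) x) => S1 S2.
move: (C x a) (dE x) (P x) (Gam x a) (g x) => c ed p G gx.
rewrite !(mulmxDl, mulmxDr) => /matrixP H; apply/matrixP => i j; move: (H i j).
rewrite !(addmxE, oppmxE, scalemxE); lra.
Qed.

Lemma lie_mult x a : A x ->
  \sum_l E x 0 l *: pdm l (M ^~ a) x =
  M x a - dE x *m M x a + M x a *m dE x - \sum_l dE x a l *: M x l.
Proof.
move=> Ax.
have dC : mdiff (C ^~ a) x by apply: msmooth_mdiff Ax; exact: smooth_dual CP CQ a.
have dh : mdiff h x by apply: msmooth_mdiff Ax; exact: smooth_inv2 CP.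
have pE l : pdm l (M ^~ a) x = pdm l h x *m C x a + h x *m pdm l (C ^~ a) x.
  by rewrite -pdmM //; congr pdm; apply/funext => y; rewrite mult_mxE.
have -> : \sum_l E x 0 l *: pdm l (M ^~ a) x =
    (\sum_l E x 0 l *: pdm l h x) *m C x a
    + h x *m \sum_l E x 0 l *: pdm l (C ^~ a) x.
  rewrite mulmx_suml mulmx_sumr -big_split; apply: eq_bigr => l _ /=.
  by rewrite pE scalerDr scalemxAl scalemxAr.
rewrite lie_inv2 // lie_dual //.
have -> : \sum_l dE x a l *: M x l = h x *m \sum_l dE x a l *: C x l.
  by rewrite mulmx_sumr; apply: eq_bigr => l _; rewrite mult_mxE scalemxAr.
rewrite mult_mxE; move: (\sum_l dE x a l *: C x l) (C x a) (dE x) => S c ed.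
move: (invmx (eta x)) => hx.
rewrite !(mulmxBl, mulmxBr, mulmxDl, mulmxDr) -!scalemxAr -!scalemxAl !mulmxA.
by apply/matrixP => i j; rewrite !(addmxE, oppmxE, scalemxE); ring.
Qed.

Lemma chart_FM3_prod v u x : msmooth A v -> msmooth A u -> A x ->
  let c y i j k := M y i j k in
  let p y := tmul (c y) (v y) (u y) in
  p x + bracket E p x =
  tmul (c x) (v x + bracket E v x) (u x) + tmul (c x) (v x) (u x + bracket E u x).
Proof.
move=> sv su Ax c p.
have tE y a b : tmul (c y) a b = b *m \sum_i a 0 i *: M y i by exact: tmulE.
have dv i : differentiable (fun y => v y 0 i) x by exact: smooth_on_diff (sv 0 i) Ax.
have du : mdiff u x by exact: msmooth_mdiff su Ax.
have dM i : mdiff (M ^~ i) x by apply: msmooth_mdiff Ax; exact: smooth_mult CP CQ i.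
pose Mv y := \sum_i v y 0 i *: M y i.
have dMv : mdiff Mv x.
  apply: (msmooth_mdiff _ Ax) => i j; rewrite /Mv; under eq_fun do rewrite summxE.
  apply: smooth_on_sum => // m _; under eq_fun do rewrite scalemxE.
  by apply: smooth_onM => //; exact: (smooth_mult CP CQ m i j).
have pE l : pdm l p x = pdm l u x *m Mv x +
    u x *m \sum_i (pd l (fun y => v y 0 i) x *: M x i + v x 0 i *: pdm l (M ^~ i) x).
  have -> : pdm l p x = pdm l (fun y => u y *m Mv y) x.
    by congr pdm; apply/funext => y; rewrite /p tE.
  rewrite pdmM //; congr (_ + _ *m _).
  exact: (@pdm_sum_scale _ _ l (fun i y => v y 0 i) (fun i y => M y i)).
rewrite !bracketE !tE /p tE -/(Mv x).
under eq_bigr do rewrite pE scalerDr scalemxAl [E x 0 _ *: (u x *m _)]scalemxAr.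
rewrite big_split /= -mulmx_suml -mulmx_sumr.
have -> : \sum_l E x 0 l *: \sum_i (pd l (fun y => v y 0 i) x *: M x i + v x 0 i *: pdm l (M ^~ i) x)
   = \sum_i (\sum_l E x 0 l *: pdm l v x) 0 i *: M x i
     + (Mv x - dE x *m Mv x + Mv x *m dE x - \sum_i (v x *m dE x) 0 i *: M x i).
  under eq_bigr do rewrite scaler_sumr.
  rewrite exchange_big /=.
  have -> : Mv x - dE x *m Mv x + Mv x *m dE x - \sum_i (v x *m dE x) 0 i *: M x i =
      \sum_i v x 0 i *: \sum_l E x 0 l *: pdm l (M ^~ i) x.
    under [RHS]eq_bigr do rewrite lie_mult // scalerBr scalerDr scalerBr.
    rewrite sumrB big_split sumrB /=; congr (_ - _ + _ - _).
    - by rewrite /Mv mulmx_sumr; apply: eq_bigr => i _; rewrite scalemxAr.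
    - by rewrite /Mv mulmx_suml; apply: eq_bigr => i _; rewrite scalemxAl.
    - under [RHS]eq_bigr do rewrite scaler_sumr.
      rewrite [RHS]exchange_big /=; apply: eq_bigr => i _.
      rewrite [(v x *m _) 0 i]mxE scaler_suml; apply: eq_bigr => m _.
      by rewrite scalerA.
  rewrite -big_split /=; apply: eq_bigr => i _.
  rewrite summxE scaler_suml scaler_sumr -big_split /=; apply: eq_bigr => l _.
  rewrite scalerDr scalerA scalemxE pdmE; congr (_ + _).
  by rewrite !scalerA mulrC.
have -> : \sum_i (v x + (\sum_l E x 0 l *: pdm l v x - v x *m dE x)) 0 i *: M x i =
    Mv x + (\sum_i (\sum_l E x 0 l *: pdm l v x) 0 i *: M x i
            - \sum_i (v x *m dE x) 0 i *: M x i).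
  rewrite /Mv -sumrB -big_split /=; apply: eq_bigr => i _.
  by rewrite !(addmxE, oppmxE) scalerDl scalerBl.
move: (\sum_i (\sum_l E x 0 l *: pdm l v x) 0 i *: M x i) (\sum_i (v x *m dE x) 0 i *: M x i) (Mv x) => S1 S2 m.
move: (\sum_l E x 0 l *: pdm l u x) (dE x) (u x) => S3 ed ux.
rewrite !(mulmxBl, mulmxBr, mulmxDl, mulmxDr) !mulmxA.
by apply/matrixP => i j; rewrite !(addmxE, oppmxE); ring.
Qed.

Lemma chart_FM3_metric v u x : msmooth A v -> msmooth A u -> A x ->
  deriv_along E (fun y => Defs.form (h y) (v y) (u y)) x
  + d * Defs.form (h x) (v x) (u x) =
  Defs.form (h x) (v x + bracket E v x) (u x)
  + Defs.form (h x) (v x) (u x + bracket E u x).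
Proof.
move=> sv su Ax.
have dv : mdiff v x by exact: msmooth_mdiff sv Ax.
have du : mdiff u x by exact: msmooth_mdiff su Ax.
have dh : mdiff h x by apply: msmooth_mdiff Ax; exact: smooth_inv2 CP.
have -> : deriv_along E (fun y => Defs.form (h y) (v y) (u y)) x =
    ((\sum_l E x 0 l *: pdm l v x) *m h x *m (u x)^T
     + v x *m (\sum_l E x 0 l *: pdm l h x) *m (u x)^T
     + v x *m h x *m (\sum_l E x 0 l *: pdm l u x)^T) 0 0.
  have -> : (\sum_l E x 0 l *: pdm l u x)^T = \sum_l E x 0 l *: (pdm l u x)^T.
    by rewrite linear_sum; apply: eq_bigr => l _; exact: linearZ.
  rewrite /deriv_along !mulmx_sumr !mulmx_suml.
  rewrite -!big_split summxE; apply: eq_bigr => l _ /=.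
  under eq_fun do rewrite formE.
  rewrite -pdmE pdmM; [|by apply: mdiffM|exact: mdiffT].
  rewrite pdmM // pdmT mulmxDl -scalemxE !scalerDr.
  congr (fun_of_matrix _ 0 0); congr (_ + _ + _).
  - by rewrite -!scalemxAl.
  - by rewrite -scalemxAr -scalemxAl.
  - by rewrite -scalemxAr.
rewrite lie_inv2 // !formE !bracketE -scalemxE -!addmxE; congr (fun_of_matrix _ 0 0).
rewrite !trmxD trmxN trmx_mul.
move: (\sum_l E x 0 l *: pdm l v x) (\sum_l E x 0 l *: pdm l u x) => S1 S2.
move: (dE x) (u x) (v x) (invmx (eta x)) => ed ux vx hx.
rewrite !(mulmxBl, mulmxBr, mulmxDl, mulmxDr, mulNmx, mulmxN).
rewrite -!scalemxAr -!scalemxAl !mulmxA.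
by apply/matrixP => i j; rewrite !(addmxE, oppmxE, scalemxE); ring.
Qed.

End EulerField.

(** * Change of chart *)

Section ChartChange.
Context {R : realType} {n : nat}.
Local Notation V := 'rV[R]_n.
Local Notation symbols := ('I_n -> 'I_n -> 'I_n -> R).

Section Connection.
Context (O : set V) (phi : V -> V).
Hypotheses (oO : open O) (sphi : msmooth O phi).

Local Notation J := (partials phi).

Lemma partialsE (v : V -> V) x i k : partials v x i k = pd i (fun y => v y 0 k) x.
Proof. by rewrite mxE pdmE. Qed.

Lemma smooth_partials : msmooth O J.
Proof.
move=> i k; under eq_fun do rewrite partialsE.
by apply: smooth_on_pd; exact: sphi.
Qed.

Lemma pdm_comp (F : V -> 'M[R]_n) x k : O x -> mdiff F (phi x) ->
  pdm k (fun y => F (phi y)) x = \sum_l J x k l *: pdm l F (phi x).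
Proof.
move=> Ox dF; apply/matrixP => i j; rewrite pdmE summxE.
rewrite (pd_comp k (f := fun z => F z i j)) //; last first.
  by move=> m; exact: smooth_on_diff (sphi 0 m) Ox.
by apply: eq_bigr => l _; rewrite scalemxE pdmE partialsE.
Qed.

(** The transformation law of Christoffel symbols: the transported connection is
    torsion-free by symmetry of second derivatives, and metric. *)
Lemma levi_civita_change (B : set V) (ha hb : V -> 'M[R]_n) x k :
  open B -> O x -> (forall y, O y -> B (phi y)) ->
  (forall z, B z -> (hb z)^T = hb z) -> (forall z, B z -> hb z \in unitmx) ->
  msmooth B hb -> (forall y, O y -> J y \in unitmx) ->
  (forall y, O y -> ha y = J y *m hb (phi y) *m (J y)^T) ->
  levi_civita ha x k *m J x =
  pdm k J x + \sum_l J x k l *: (J x *m levi_civita hb (phi x) l).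
Proof.
move=> oB Ox OB sb ub smb uJ hE.
pose X k := pdm k J x + \sum_l J x k l *: (J x *m levi_civita hb (phi x) l).
have Bx := OB x Ox; have uJx := uJ x Ox.
have jE i m a : (\sum_l J x i l *: (J x *m levi_civita hb (phi x) l)) m a =
    \sum_l \sum_s J x i l * (J x m s * levi_civita hb (phi x) l s a).
  by rewrite summxE; apply: eq_bigr => l _; rewrite scalemxE [(J x *m _) m a]mxE mulr_sumr.
have sX i m a : X i m a = X m i a.
  rewrite /X !addmxE !jE; congr (_ + _).
    rewrite !pdmE; under eq_fun do rewrite partialsE.
    under [X in _ = pd _ X _]eq_fun do rewrite partialsE.
    by apply: (pd_swap _ _ oO Ox); exact: sphi.
  rewrite exchange_big /=; apply: eq_bigr => s _; apply: eq_bigr => l _.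
  rewrite (levi_civita_torsion_free oB Bx sb); ring.
have dJ : mdiff J x by apply: msmooth_mdiff Ox; exact: smooth_partials.
have dhb : mdiff hb (phi x) by exact: msmooth_mdiff smb Bx.
have dp : differentiable phi x.
  by apply: differentiable_row => m; exact: smooth_on_diff (sphi 0 m) Ox.
have dhp : mdiff (fun y => hb (phi y)) x.
  move=> i j; exact: (differentiable_comp dp (dhb i j)).
suff H : forall m, levi_civita ha x m = X m *m invmx (J x) by rewrite H mulmxKV.
apply: (levi_civita_unique oO Ox).
- by move=> y Oy; rewrite hE // !trmx_mul trmxK sb ?mulmxA //; exact: OB.
- by rewrite hE // !unitmx_mul unitmx_tr uJx ub.
- by move=> i m a; rewrite [LHS]mxE [RHS]mxE; apply: eq_bigr => s _; rewrite sX.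
move=> m; rewrite (pdm_eq_on _ oO Ox hE) pdmM; [|exact: mdiffM|exact: mdiffT].
rewrite pdmM // pdmT pdm_comp // hE // trmx_mul.
have -> : \sum_l J x m l *: pdm l hb (phi x) =
   (\sum_l J x m l *: levi_civita hb (phi x) l) *m hb (phi x) +
   hb (phi x) *m (\sum_l J x m l *: levi_civita hb (phi x) l)^T.
  rewrite mulmx_suml linear_sum mulmx_sumr -big_split; apply: eq_bigr => l _ /=.
  rewrite (levi_civita_metric l oB Bx sb) ?ub // scalerDr scalemxAl; congr (_ + _).
  by rewrite scalemxAr; congr (_ *m _); rewrite linearZ.
have -> : X m = pdm m J x + J x *m \sum_l J x m l *: levi_civita hb (phi x) l.
  by rewrite /X mulmx_sumr; congr (_ + _); apply: eq_bigr => l _; rewrite scalemxAr.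
move: (\sum_l J x m l *: levi_civita hb (phi x) l) (pdm m J x) (hb (phi x)) => S p hx.
have KE (Y : 'M[R]_n) : Y *m invmx (J x) *m (J x *m hx *m (J x)^T) = Y *m hx *m (J x)^T.
  by rewrite !mulmxA mulmxKV.
rewrite KE trmxD !trmx_mul.
have KT (Y : 'M[R]_n) : J x *m hx *m (J x)^T *m ((invmx (J x))^T *m Y) = J x *m hx *m Y.
  by rewrite !mulmxA -(mulmxA _ (J x)^T) -trmx_mul mulVmx // trmx1 mulmx1.
rewrite KT; move: (J x) => j.
rewrite !(mulmxDl, mulmxDr) !mulmxA.
by apply/matrixP => a b; rewrite !(addmxE, oppmxE); ring.
Qed.

End Connection.

Context (d : R) (O : set V) (phi : V -> V).
Context (A : set V) (g eta : V -> 'M[R]_n) (G1 G2 : V -> symbols) (w E e : V -> V).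
Context (A' : set V) (g' eta' : V -> 'M[R]_n) (G1' G2' : V -> symbols)
  (w' E' e' : V -> V).
Hypotheses (oO : open O) (sphi : msmooth O phi) (OA : O `<=` A).
Hypothesis OA' : forall y, O y -> A' (phi y).
Hypotheses (CP : chart_pencil A g eta G1 G2) (CP' : chart_pencil A' g' eta' G1' G2').
Hypotheses (CQ : chart_quasihomogeneous d A g eta w E e)
  (CQ' : chart_quasihomogeneous d A' g' eta' w' E' e').

Local Notation J := (partials phi).

Hypothesis uJ : forall y, O y -> J y \in unitmx.
Hypothesis gE : forall y, O y -> g' (phi y) = (J y)^T *m g y *m J y.
Hypothesis etaE : forall y, O y -> eta' (phi y) = (J y)^T *m eta y *m J y.
Hypothesis wE : forall y, O y -> w y = w' (phi y) *m (J y)^T.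

Lemma inv_change (M N K : 'M[R]_n) : M \in unitmx -> N \in unitmx ->
  K = M^T *m N *m M -> invmx N = M *m invmx K *m M^T.
Proof.
move=> uM uN ->; rewrite -[LHS]mulmx1.
have uK : M^T *m N *m M \in unitmx by rewrite !unitmx_mul unitmx_tr uM uN.
apply: (canLR (mulKmx uN)).
have -> : N *m (M *m invmx (M^T *m N *m M) *m M^T) =
    invmx M^T *m ((M^T *m N *m M) *m invmx (M^T *m N *m M)) *m M^T.
  by rewrite !mulmxA mulVmx ?unitmx_tr // mul1mx.
by rewrite mulmxV // mulmx1 mulVmx ?unitmx_tr.
Qed.

(** Near a point some member of the pencil is invertible, and [Delta] is the
    difference of two Levi-Civita connections, in which second derivatives of the
    change of coordinates cancel. *)
Lemma delta_change x k : O x ->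
  (J x)^T *m delta_mxs g eta G1 x k *m J x =
  \sum_l J x k l *: delta_mxs g' eta' G1' (phi x) l.
Proof.
move=> Ox; have Ax := OA Ox; have Ax' := OA' Ox.
have [l [_ [_ [_ [ul _ _]]]]] := three_regular_parameters (g x) (cp_unit CP Ax).
pose a y := g y - l *: eta y; pose a' y := g' y - l *: eta' y.
have aE y : O y -> a' (phi y) = (J y)^T *m a y *m J y.
  move=> Oy; rewrite /a' /a gE // etaE // mulmxBr mulmxBl.
  by rewrite -scalemxAr -scalemxAl.
have sa : msmooth O a.
  have sA p q (F : V -> 'M[R]_(p, q)) : msmooth A F -> msmooth O F.
    by move=> sF i j; apply: smooth_onS (sF i j).
  apply: msmoothD => //; first exact/sA/(cp_smooth1 CP).
  by apply: msmoothN => //; apply: msmoothZ => //; exact/sA/(cp_smooth2 CP).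
have oA' := cp_open CP'.
have sa' : msmooth A' a'.
  apply: msmoothD => //; first exact: cp_smooth1 CP'.
  by apply: msmoothN => //; apply: msmoothZ => //; exact: cp_smooth2 CP'.
pose O1 := [set y | O y /\ a y \in unitmx].
pose B1 := [set y | A' y /\ a' y \in unitmx].
have oO1 : open O1 by exact: open_unitmx.
have oB1 : open B1 by exact: open_unitmx.
have sphi1 : msmooth O1 phi by move=> i j; apply: smooth_onS (sphi i j) => y [].
have O1x : O1 x by [].
have ux' : a' (phi x) \in unitmx.
  by rewrite aE // !unitmx_mul unitmx_tr uJ // ul.
have L2 : conn2 eta x k *m J x = pdm k J x + \sum_l J x k l *: (J x *m conn2 eta' (phi x) l).
  rewrite /conn2; apply: (levi_civita_change (ha := fun z => invmx (eta z))
    (hb := fun z => invmx (eta' z)) oO sphi k oA' Ox OA').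
  - exact: sym_inv2 CP'.
  - exact: unit_inv2 CP'.
  - exact: smooth_inv2 CP'.
  - exact: uJ.
  - move=> y Oy; apply: inv_change; [exact: uJ|exact: cp_unit CP _ (OA Oy)|exact: etaE].
have La : levi_civita (fun z => invmx (a z)) x k *m J x = pdm k J x +
    \sum_m J x k m *: (J x *m levi_civita (fun z => invmx (a' z)) (phi x) m).
  apply: (levi_civita_change (ha := fun z => invmx (a z))
    (hb := fun z => invmx (a' z)) oO1 sphi1 k oB1 O1x).
  - move=> y [Oy uy]; split; first exact: OA'.
    by rewrite aE // !unitmx_mul unitmx_tr uJ // uy.
  - move=> z [Az _]; apply: invmx_sym; rewrite /a' linearB linearZ /=.
    by rewrite (cp_sym1 CP' Az) (cp_sym2 CP' Az).
  - by move=> z [_ uz]; rewrite unitmx_inv.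
  - apply: msmoothV => // [z []//|].
    by move=> i j; apply: smooth_onS (sa' i j) => z [].
  - by move=> y [Oy _]; exact: uJ.
  - by move=> y [Oy uy]; apply: inv_change; [exact: uJ|exact: uy|exact: aE].
have DE := pencil_difference CP k Ax ul.
have DE' m := pencil_difference CP' m Ax' ux'.
have -> : delta_mxs g eta G1 x k = - (a x *m (levi_civita (fun z => invmx (a z)) x k - conn2 eta x k)).
  by rewrite DE opprK.
rewrite mulmxN mulNmx -!mulmxA (mulmxBl _ _ (J x)) La L2 opprD addrACA subrr add0r -sumrB.
rewrite !mulmx_sumr -sumrN; apply: eq_bigr => m _.
rewrite -scalerBr -mulmxBr -!scalemxAr -scalerN; congr (_ *: _).
by rewrite !mulmxA -aE // DE' opprK.
Qed.

Lemma euler_op_change x : O x ->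
  euler_op d eta E x *m J x = J x *m euler_op d eta' E' (phi x).
Proof.
move=> Ox; have Ax := OA Ox; have Ax' := OA' Ox.
apply/row_matrixP => k; rewrite !row_mul (row_euler_op CP CQ) // wE //.
rewrite -!mulmxA (mulmxA (J x)^T) delta_change //.
apply/rowP => j; rewrite mulmx_sumr summxE [RHS]mxE; apply: eq_bigr => l _.
rewrite -scalemxAr scalemxE [X in _ = X * _]mxE; congr (_ * _).
have := congr1 (fun r : V => r 0 j) (row_euler_op CP' CQ' l Ax').
by rewrite [LHS]mxE => ->.
Qed.

Lemma mult_change x i : O x ->
  mult_mx d g eta G1 E x i *m J x =
  \sum_k J x i k *: (J x *m mult_mx d g' eta' G1' E' (phi x) k).
Proof.
move=> Ox; have Ax := OA Ox; have Ax' := OA' Ox; have uJx := uJ Ox.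
have uR := unit_euler_op CQ Ax; have uR' := unit_euler_op CQ' Ax'.
have RJ : invmx (euler_op d eta E x) *m J x = J x *m invmx (euler_op d eta' E' (phi x)).
  apply: (canLR (mulKmx uR)); rewrite mulmxA euler_op_change //.
  by rewrite mulmxK.
rewrite mult_mxE dual_mxE -!mulmxA RJ.
rewrite (inv_change uJx (cp_unit CP Ax) (etaE Ox)) -!mulmxA.
rewrite (mulmxA (delta_mxs _ _ _ _ _)) (mulmxA (J x)^T) (mulmxA (J x)^T) delta_change //.
rewrite mulmx_suml !mulmx_sumr; apply: eq_bigr => k _.
by rewrite -scalemxAl -!scalemxAr mult_mxE dual_mxE.
Qed.

End ChartChange.

(** * Charts of the manifold *)

Section Charts.
Context {R : realType} {n : nat} (M : manifold R n).
Local Notation V := 'rV[R]_n.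
Implicit Types (U : set M) (a b : chart M) (p : M).

Lemma open_within_preimage (S T : topologicalType) (f : S -> T) (D : set S) (B : set T) :
  open D -> {within D, continuous f} -> open B -> open (D `&` f @^-1` B).
Proof.
move=> oD; rewrite continuous_open_subspace // => cf oB.
rewrite openE => x [Dx Bx].
apply: filterI; first exact: open_nbhs_nbhs.
by apply: (cf x); [exact: mem_set|exact: open_nbhs_nbhs].
Qed.

Lemma patch_preimage U a :
  Defs.patch U a = (coord a @` dom a) `&` param a @^-1` U.
Proof.
apply/seteqP; split=> [x [p [ap Up] <-]|x [[p ap <-]]] /=.
  by rewrite coordK //; split=> //; exists p.
by rewrite coordK // => Up; exists p.
Qed.

Lemma open_patch U a : open U -> open (Defs.patch U a).
Proof.
move=> oU; rewrite patch_preimage; apply: open_within_preimage => //.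
  exact: coord_open.
exact: param_continuous.
Qed.

Lemma open_coord_preimage a (O : set V) : open O -> open (dom a `&` coord a @^-1` O).
Proof.
move=> oO; apply: open_within_preimage => //; first exact: dom_open.
exact: coord_continuous.
Qed.

Definition transition a b (x : V) : V := coord b (param a x).

Definition overlap U a b : set V := Defs.patch (dom b `&` U) a.

Lemma open_overlap U a b : open U -> open (overlap U a b).
Proof. by move=> oU; apply: open_patch; apply: openI => //; exact: dom_open. Qed.

Lemma overlapP U a b x : overlap U a b x ->
  exists p, [/\ dom a p, dom b p, U p & x = coord a p].
Proof. by move=> [p [ap [bp Up]] <-]; exists p. Qed.

Lemma overlap_coord U a b p : dom a p -> dom b p -> U p -> overlap U a b (coord a p).
Proof. by move=> ap bp Up; exists p. Qed.

Lemma smooth_transition U a b : msmooth (overlap U a b) (transition a b).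
Proof.
move=> i k; rewrite ord1.
have H := @transition_smooth R n M a b k.
apply: (smooth_onS _ H) => x [p [ap [bp _]] <-]; by exists p.
Qed.

Lemma pd_coord i k (x : V) : pd i (fun y : V => y 0 k) x = (i == k)%:R.
Proof.
have D : derivable (id : V -> V) x (delta_mx 0 i) by exact: derivable_id.
have := congr1 (fun r : V => r 0 k) (derive_mx D).
by rewrite /pd derive_id !mxE eqxx /= (eq_sym i) => <-.
Qed.

Lemma jacE a b p : dom a p -> dom b p -> jac a b p = partials (transition a b) (coord a p).
Proof.
move=> ap bp; apply/matrixP => i k; rewrite jacobianE ?partialsE // => m.
have op : overlap setT a b (coord a p) by exact: overlap_coord.
exact: smooth_on_diff (smooth_transition (U := setT) 0 m) op.
Qed.

Lemma partials_transition_unit a b p : dom a p -> dom b p ->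
  partials (transition a b) (coord a p) \in unitmx.
Proof.
move=> ap bp; set x := coord a p.
have ox : overlap setT a b x by exact: overlap_coord.
have oy : overlap setT b a (transition a b x).
  by rewrite /transition coordK //; exact: overlap_coord.
have oO : open (overlap setT a b) by apply: open_overlap; exact: openT.
suff H : partials (transition a b) x *m partials (transition b a) (transition a b x) = 1%:M.
  by have [] := mulmx1_unit H.
apply/matrixP => i k; rewrite [LHS]mxE [RHS]mxE -(pd_coord i k x).
have -> : pd i (fun y : V => y 0 k) x =
          pd i (fun y => transition b a (transition a b y) 0 k) x.
  apply: (pd_eq_on _ oO ox) => y /overlapP [q [aq bq _ ->]].
  by rewrite /transition !coordK.
rewrite (pd_comp i (f := fun z => transition b a z 0 k)).
- by apply: eq_bigr => l _; rewrite !partialsE.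
- by move=> m; exact: smooth_on_diff (smooth_transition (U := setT) 0 m) ox.
- exact: smooth_on_diff (smooth_transition (U := setT) 0 k) oy.
Qed.

Section Contravariant.
Context (g : components M 'M[R]_n) (cg : contra_tensor setT g).

Lemma contra_change a b p : dom a p -> dom b p ->
  g b (coord b p) = (partials (transition a b) (coord a p))^T *m g a (coord a p)
    *m partials (transition a b) (coord a p).
Proof. by move=> ap bp; rewrite (cg.2 a b p) // jacE. Qed.

(** By the transformation law, one chart decides. *)
Lemma nondegenerate_chart a p : dom a p ->
  nondegenerate_locus g p <-> g a (coord a p) \in unitmx.
Proof.
move=> ap; split=> [H|ug b bp]; first exact: H.
by rewrite (contra_change ap bp) !unitmx_mul unitmx_tr partials_transition_unit // ug.
Qed.

Lemma smooth_contra U a : msmooth (Defs.patch U a) (g a).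
Proof.
by move=> i j; apply: smooth_onS (cg.1 a i j) => x [p [ap Up] <-]; exists p.
Qed.

Lemma open_nondegenerate : open (nondegenerate_locus g).
Proof.
rewrite openE => p ng; have [a ap] := dom_cover p.
have oT : open (Defs.patch (setT : set M) a) by apply: open_patch; exact: openT.
have oO : open [set x | Defs.patch setT a x /\ g a x \in unitmx].
  by apply: open_unitmx => //; exact: smooth_contra.
apply: (filterS _ (open_nbhs_nbhs (conj (open_coord_preimage a oO) _))).
  by move=> q [aq [_ uq]]; apply/(nondegenerate_chart aq).
by split=> //; split; [exists p|exact: ng].
Qed.

End Contravariant.

End Charts.

(** * The Frobenius manifold of a flat pencil *)

Section FrobeniusOfPencil.
Context {R : realType} {n : nat} (M : manifold R n) (d : R).
Local Notation V := 'rV[R]_n.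
Local Notation symbols := ('I_n -> 'I_n -> 'I_n -> R).
Context (g1 g2 : components M 'M[R]_n) (G1 G2 : components M symbols) (tau : M -> R).

Local Notation E := (gradient g1 tau).
Local Notation e := (gradient g2 tau).
Local Notation M0 := (nondegenerate_locus g2).

Hypothesis FP : flat_pencil g1 g2 G1 G2.
Hypothesis QH : quasihomogeneous d g1 g2 tau.
Hypothesis RG : regular d g2 E.

Definition dtau (a : chart M) (x : V) : V :=
  \row_s pd s (fun y => tau (param a y)) x.

Let t1 : contra_tensor setT g1 := cm_tensor (fp_metric1 FP).
Let t2 : contra_tensor setT g2 := cm_tensor (fp_metric2 FP).

Let patchT a x : patch M0 a x -> patch setT a x.
Proof. by move=> [p [ap _] <-]; exists p. Qed.

Let patch_unit a x : patch M0 a x -> g2 a x \in unitmx.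
Proof. by move=> [p [ap Np] <-]; exact: Np. Qed.

Lemma patch_pencil l a x : patch M0 a x -> g1 a x - l *: g2 a x \in unitmx ->
  patch (nondegenerate_locus (pencil g1 g2 l)) a x.
Proof.
move=> [p [ap Np] <-] ul; exists p => //; split=> //.
exact/(nondegenerate_chart (cm_tensor (fp_metric FP l)) ap).
Qed.

Lemma pencil_in_chart a :
  chart_pencil (patch M0 a) (g1 a) (g2 a) (G1 a) (G2 a).
Proof.
split.
- by apply: open_patch; exact: open_nondegenerate.
- exact: smooth_contra.
- exact: smooth_contra.
- move=> k i j; under eq_fun do rewrite mxE.
  have H : smooth_on (patch setT a) (fun x => G1 a x k i j).
    by apply: clc_smooth; exact: fp_conn1 FP.
  by apply: (smooth_onS _ H) => y; exact: patchT.
- by move=> y /patchT; exact: cm_sym (fp_metric1 FP) a y.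
- by move=> y /patchT; exact: cm_sym (fp_metric2 FP) a y.
- exact: patch_unit.
- by move=> y Uy k i j; exact: (clc_def (fp_conn2 FP) Uy k i j).
- move=> l y Uy ul k i j.
  exact: (clc_def (fp_conn FP l) (patch_pencil Uy ul) k i j).
- move=> l y Uy ul i j k m.
  exact: (fp_flat FP (patch_pencil Uy ul) i j k m).
Qed.

Lemma gradientE (g : components M 'M[R]_n) a x : (g a x)^T = g a x ->
  gradient g tau a x = dtau a x *m g a x.
Proof.
move=> sg; apply/rowP => i; rewrite [LHS]mxE [RHS]mxE; apply: eq_bigr => s _.
by rewrite [dtau _ _ _ _]mxE mulrC ((mx_sym _).2 sg).
Qed.

Lemma quasihomogeneous_in_chart a :
  chart_quasihomogeneous d (patch M0 a) (g1 a) (g2 a) (dtau a) (E a) (e a).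
Proof.
have CP := pencil_in_chart a; have oP := cp_open CP.
have st : smooth_on (patch M0 a) (fun x => tau (param a x)).
  have H : smooth_on (patch setT a) (fun x => tau (param a x)) by exact: qh_smooth QH a.
  by apply: (smooth_onS _ H) => y; exact: patchT.
split.
- by move=> i j; under eq_fun do rewrite mxE; exact: smooth_on_pd.
- move=> y Uy; apply/mx_sym => i j; rewrite !partialsE.
  under eq_fun do rewrite mxE; under [X in _ = pd _ X _]eq_fun do rewrite mxE.
  exact: pd_swap oP Uy st.
- by move=> y Uy; apply: gradientE; exact: cp_sym1 CP _ Uy.
- by move=> y Uy; apply: gradientE; exact: cp_sym2 CP _ Uy.
- by move=> y Uy; exact: (qh_lie_E1 QH (patchT Uy)).
- by move=> y Uy; exact: (qh_lie_e1 QH (patchT Uy)).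
- by move=> y Uy; exact: (qh_lie_e2 QH (patchT Uy)).
- move=> O oO OP [x Ox]; have [W [oW dW WN]] := cm_nondeg (fp_metric1 FP).
  have [|q [[aq Oq] Wq]] := dW _ _ (open_coord_preimage a oO).
    by have [p [ap _] px] := OP x Ox; exists p; split=> //=; rewrite px.
  by exists (coord a q) => //; exact: (WN q Wq a aq).
- by move=> y Uy; exact: (RG Uy).
Qed.

(** The product of tangent vectors has [c_{ij}^k = g2_{jb} Delta_i^{bm} (R^{-1})_m^k],
    which by total symmetry is the dual of the product of 1-forms. *)
Definition pencil_frobenius : frobenius_data M :=
  FrobeniusData
    (fun a x i j k => mult_mx d (g1 a) (g2 a) (G1 a) (E a) x i j k)
    (inverse g2) e E.

Section Transition.
Context (a b : chart M).
Let O := overlap M0 a b.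
Let phi := transition a b.

Let OA : O `<=` patch M0 a. Proof. by move=> x [p [ap [bp Np]] <-]; exists p. Qed.

Let OB x : O x -> patch M0 b (phi x).
Proof.
by move=> [p [ap [bp Np]] <-]; exists p => //; rewrite /phi /transition coordK.
Qed.

Let uJ x : O x -> partials phi x \in unitmx.
Proof. by move=> [p [ap [bp _]] <-]; exact: partials_transition_unit. Qed.

Lemma contra_overlap (g : components M 'M[R]_n) x : contra_tensor setT g -> O x ->
  g b (phi x) = (partials phi x)^T *m g a x *m partials phi x.
Proof.
move=> tg [p [ap [bp _]] <-].
by rewrite -(contra_change tg ap bp) /phi /transition coordK.
Qed.

Lemma open_M0_overlap : open O.
Proof. by apply: open_overlap; exact: open_nondegenerate. Qed.

Lemma dtau_change x : O x -> dtau a x = dtau b (phi x) *m (partials phi x)^T.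
Proof.
move=> Ox; apply/rowP => i; rewrite [LHS]mxE [RHS]mxE.
have -> : pd i (fun y => tau (param a y)) x = pd i (fun y => tau (param b (phi y))) x.
  apply: (pd_eq_on _ open_M0_overlap Ox) => y /overlapP [q [aq bq _ ->]].
  by rewrite /phi /transition !coordK.
have st : smooth_on (patch setT b) (fun z => tau (param b z)) by exact: qh_smooth QH b.
have dt := smooth_on_diff st (patchT (OB Ox)).
have dp k : differentiable (fun y => phi y 0 k) x.
  by apply: smooth_on_diff Ox; exact: (smooth_transition 0 k).
rewrite (pd_comp i dp dt).
apply: eq_bigr => l _; rewrite [dtau _ _ _ _]mxE [_^T _ _]mxE partialsE.
exact: mulrC.
Qed.

Lemma gradient_change (g : components M 'M[R]_n) x :
  contra_tensor setT g -> (forall c y, patch setT c y -> (g c y)^T = g c y) -> O x ->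
  gradient g tau b (phi x) = gradient g tau a x *m partials phi x.
Proof.
move=> tg sg Ox; have Ax := OA Ox; have Bx := OB Ox.
rewrite !gradientE; [|exact/sg/patchT|exact/sg/patchT].
by rewrite (contra_overlap tg Ox) (dtau_change Ox) !mulmxA.
Qed.

Lemma mult_overlap x i : O x ->
  mult_mx d (g1 a) (g2 a) (G1 a) (E a) x i *m partials phi x =
  \sum_k partials phi x i k *:
    (partials phi x *m mult_mx d (g1 b) (g2 b) (G1 b) (E b) (phi x) k).
Proof.
move=> Ox.
apply: (mult_change open_M0_overlap (smooth_transition (U := M0) (a := a) (b := b)) OA OB
  (pencil_in_chart a) (pencil_in_chart b) (quasihomogeneous_in_chart a)
  (quasihomogeneous_in_chart b) uJ) => //.
- by move=> y; exact: contra_overlap.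
- by move=> y; exact: contra_overlap.
- exact: dtau_change.
Qed.

End Transition.

Lemma gradient_vector_field (g : components M 'M[R]_n) :
  contra_tensor setT g -> (forall c y, patch setT c y -> (g c y)^T = g c y) ->
  vector_field M0 (gradient g tau).
Proof.
move=> tg sg; split.
  move=> a k; have CP := pencil_in_chart a; have oP := cp_open CP.
  have CQ := quasihomogeneous_in_chart a.
  have H := msmoothM oP (cq_smooth CQ) (smooth_contra tg (U := M0) (a := a)).
  apply: (smooth_on_eq oP _ (H 0 k)) => y Uy.
  by rewrite gradientE //; exact/sg/patchT.
move=> a b p Np ap bp; rewrite jacE //.
have Op : overlap M0 a b (coord a p) by exact: overlap_coord.
by rewrite -(gradient_change tg sg Op) /transition coordK.
Qed.

Lemma pencil_frobenius_structure : frobenius_structure M0 d pencil_frobenius.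
Proof.
have CP a := pencil_in_chart a; have CQ a := quasihomogeneous_in_chart a.
split.
- exact: open_nondegenerate.
- split; first by move=> a i j k; exact: (smooth_mult (CP a) (CQ a) i j k).
  move=> a b p Np ap bp i j r; rewrite jacE //.
  have Op : overlap M0 a b (coord a p) by exact: overlap_coord.
  have := congr1 (fun m : 'M[R]_n => m j r) (mult_overlap i Op).
  rewrite [LHS]mxE summxE /= => ->; apply: eq_bigr => k _.
  rewrite scalemxE [(partials _ _ *m _) j r]mxE mulr_sumr; apply: eq_bigr => l _.
  by rewrite /transition coordK // mulrA.
- split; first by move=> a i j; exact: (smooth_inv2 (CP a) i j).
  move=> a b p Np ap bp; rewrite jacE // /inverse.
  apply: inv_change; [exact: partials_transition_unit|exact: Np|exact: contra_change].
- exact: gradient_vector_field t2 (cm_sym (fp_metric2 FP)).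
- exact: gradient_vector_field t1 (cm_sym (fp_metric1 FP)).
- by move=> a x Ux; exact: (chart_frobenius_algebra (CP a) (CQ a) Ux).
- by move=> a x Ux i j k l; exact: (chart_flat (CP a) i j k l Ux).
- by move=> a x Ux i j; exact: (chart_unit_parallel (CP a) (CQ a) i j Ux).
- move=> a x Ux l i j k; rewrite /nabla_c /=.
  have -> : (fun y i j k => \sum_m mult_mx d (g1 a) (g2 a) (G1 a) (E a) y i j m
      * inverse g2 a y m k) =
      (fun y i j k => lower_mx d (g1 a) (g2 a) (G1 a) (E a) y i j k).
    by apply/funext => y; apply/funext => s; apply/funext => t; apply/funext => m;
       rewrite [RHS]mxE.
  exact: (chart_FM2 (CP a) (CQ a) l i j k Ux).
- by move=> a x Ux i j k; exact: (chart_euler_affine (CP a) (CQ a) i j k Ux).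
- move=> v w [sv _] [sw _] a x Ux.
  apply: (chart_FM3_prod (CP a) (CQ a) (v := v a) (u := w a)) => //.
  + by move=> i j; rewrite ord1; exact: sv.
  + by move=> i j; rewrite ord1; exact: sw.
- move=> v w [sv _] [sw _] a x Ux.
  apply: (chart_FM3_metric (CP a) (CQ a) (v := v a) (u := w a)) => //.
  + by move=> i j; rewrite ord1; exact: sv.
  + by move=> i j; rewrite ord1; exact: sw.
Qed.

(** The connection of ( , )_2 in [Delta^{sij}] is traded for its Christoffel symbols;
    the symmetry of [Delta] then allows either of its first two indices to be
    lowered. *)
Lemma DeltaE a x u v : patch M0 a x ->
  Delta g1 g2 G1 G2 a x u (Rinv d g2 E a x v) =
  \row_k (u *m dual_mx d (g1 a) (g2 a) (G1 a) (E a) x k *m v^T) 0 0.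
Proof.
move=> Ux; have CP := pencil_in_chart a.
have DE k i j : \sum_s inverse g2 a x k s * Delta_up g1 g2 G1 G2 a x s i j =
    delta_mxs (g1 a) (g2 a) (G1 a) x k i j.
  have up s : Delta_up g1 g2 G1 G2 a x s i j =
      \sum_t g2 a x s t * delta_mxs (g1 a) (g2 a) (G1 a) x t i j.
    rewrite (delta_sym2 CP s i j Ux) /Delta_up sumrB.
    have -> : \sum_t g1 a x s t * G2 a x t i j =
        - \sum_t g2 a x i t * (g1 a x *m conn2 (g2 a) x t) s j.
      have G2E t : G2 a x t i j = - \sum_m g2 a x i m * conn2 (g2 a) x t m j.
        have := congr1 (fun m : 'M[R]_n => m i j) (conn2E CP t Ux).
        by rewrite [LHS]mxE oppmxE [connection_mx _ _ _ _]mxE => ->; rewrite opprK.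
      under eq_bigr do rewrite G2E mulrN mulr_sumr.
      rewrite sumrN exchange_big /=; congr (- _); apply: eq_bigr => m _.
      rewrite mxE mulr_sumr; apply: eq_bigr => t _.
      by rewrite (conn2_torsion_free CP Ux); ring.
    rewrite opprK -big_split /=; apply: eq_bigr => t _.
    by rewrite -mulrDr [delta_mxs _ _ _ _ _ _ _]mxE [connection_mx _ _ _ _]mxE.
  under eq_bigr do rewrite up.
  have := congr1 (fun m : 'cV[R]_n => m k 0) (mulKmx (patch_unit Ux)
    (\col_t delta_mxs (g1 a) (g2 a) (G1 a) x t i j)).
  rewrite [X in _ = X -> _]mxE => <-; rewrite [RHS]mxE.
  apply: eq_bigr => s _; congr (_ * _); rewrite [RHS]mxE.
  by apply: eq_bigr => t _; rewrite [X in _ = _ * X]mxE.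
apply/rowP => k; rewrite [LHS]mxE [RHS]mxE dual_mxE.
under eq_bigr do under eq_bigr do rewrite DE.
have RE j : Rinv d g2 E a x v 0 j = (invmx (euler_op d (g2 a) (E a) x) *m v^T) j 0.
  rewrite [LHS]mxE [RHS]mxE; apply: eq_bigr => m _.
  by rewrite [_^T _ _]mxE.
rewrite mulmxA -mulmxA [RHS]mxE exchange_big; apply: eq_bigr => j _ /=.
rewrite RE [X in _ = X * _]mxE mulr_suml; apply: eq_bigr => i _; ring.
Qed.

Lemma frobenius_of_pencil_exists :
  frobenius_of_pencil d g1 g2 G1 G2 E e pencil_frobenius.
Proof.
have DP a x u v : patch M0 a x -> dual_prod pencil_frobenius a x u v =
    \row_k (u *m dual_mx d (g1 a) (g2 a) (G1 a) (E a) x k *m v^T) 0 0.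
  move=> Ux; apply/rowP => k; rewrite [RHS]mxE /dual_prod /flat /sharp /= /inverse !invmxK.
  exact: (dual_productE (pencil_in_chart a) (quasihomogeneous_in_chart a) u v k Ux).
split.
- exact: pencil_frobenius_structure.
- by move=> a x _; exact: invmxK.
- by move=> a x Ux u v; rewrite DP // DeltaE.
- by [].
- by [].
- move=> a x Ux u v; rewrite /intersection_form DP //=.
  rewrite -(intersectionE (pencil_in_chart a) (quasihomogeneous_in_chart a) u v Ux).
  by apply: eq_bigr => k _; rewrite [X in _ * X]mxE.
Qed.

(** The metric is prescribed, hence so are the raising and lowering of indices
    through which the dual product determines the product. *)
Lemma frobenius_of_pencil_unique (F F' : frobenius_data M) :
  frobenius_of_pencil d g1 g2 G1 G2 E e F ->
  frobenius_of_pencil d g1 g2 G1 G2 E e F' -> eq_frobenius M0 F F'.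
Proof.
move=> HF HF' a x Ux.
have hE : fmetric F a x = fmetric F' a x.
  by rewrite -[LHS]invmxK -[RHS]invmxK (fop_metric HF Ux) (fop_metric HF' Ux).
split=> //.
- move=> i j k.
  have uh : fmetric F a x \in unitmx.
    by rewrite -[X in X \in _]invmxK unitmx_inv (fop_metric HF Ux) patch_unit.
  have := fop_prod HF Ux (delta_mx 0 i *m fmetric F a x) (delta_mx 0 j *m fmetric F a x).
  rewrite -(fop_prod HF' Ux) /dual_prod /flat /sharp -hE !mulmxK //.
  move=> /(congr1 (mulmx^~ (invmx (fmetric F a x)))); rewrite !mulmxK //.
  have tE c : tmul c (delta_mx 0 i) (delta_mx 0 j) 0 k = c i j k.
    rewrite mxE (bigD1 i) //= (bigD1 j) //= !mxE !eqxx /= !mulr1.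
    rewrite big1 => [|l lj]; last by rewrite !mxE (negbTE lj) andbF mulr0.
    rewrite big1 ?addr0 // => l li; rewrite big1 // => m _.
    by rewrite !mxE (negbTE li) andbF mulr0 mul0r.
  by move=> /(congr1 (fun r : V => r 0 k)); rewrite !tE.
- by rewrite (fop_unit HF Ux) (fop_unit HF' Ux).
- by rewrite (fop_euler HF Ux) (fop_euler HF' Ux).
Qed.

End FrobeniusOfPencil.

Theorem theorem2p1 (R : realType) (n : nat) (M : manifold R n) (d : R)
    (g1 g2 : components M 'M[R]_n)
    (G1 G2 : components M ('I_n -> 'I_n -> 'I_n -> R)) (tau : M -> R)
    (E e : components M 'rV[R]_n) :
  E = gradient g1 tau ->
  e = gradient g2 tau ->
  flat_pencil g1 g2 G1 G2 ->
  quasihomogeneous d g1 g2 tau ->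
  regular d g2 E ->
  exists F : frobenius_data M,
    frobenius_of_pencil d g1 g2 G1 G2 E e F /\
    (forall F' : frobenius_data M,
       frobenius_of_pencil d g1 g2 G1 G2 E e F' ->
       eq_frobenius (nondegenerate_locus g2) F F').
Proof.
move=> -> -> FP QH RG; exists (pencil_frobenius d g1 g2 G1 tau).
have HF := frobenius_of_pencil_exists FP QH RG.
by split=> // F'; exact: frobenius_of_pencil_unique HF.
Qed.
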